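(* Let $n\geq 33$ and let $G$ be a 2-connected claw-free graph on $n$ vertices. If $\mu(G)\geq\mu(EP_n)$, then $G$ is Hamiltonian unless $G\cong EP_n$.
   Context: All graphs are finite and simple. A graph is claw-free if it has no induced subgraph isomorphic to $K_{1,3}$. $\mu(H)$ denotes the spectral radius (largest adjacency eigenvalue) of a graph $H$. For $n\geq 9$, $EP_n$ is the graph on $n$ vertices defined as follows: take a clique $Q$ on $n-6$ vertices with three distinct distinguished vertices $a_1,a_2,a_3\in Q$, and six further vertices $b_1,b_2,b_3,c_1,c_2,c_3$; the edges are all pairs inside $Q$, the edges $b_1b_2,b_2b_3,b_1b_3$, and for each $i\in\{1,2,3\}$ the edges $a_ib_i$, $a_ic_i$, $b_ic_i$ (and no others). *)

(* Defs.v *)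
From mathcomp Require Import all_boot all_order all_algebra.
From mathcomp Require Import classical_sets reals.

Set Implicit Arguments.
Unset Strict Implicit.
Unset Printing Implicit Defensive.

Record sgraph := SGraph {
  vertex :> finType;
  adj : rel vertex;
  adj_sym : symmetric adj;
  adj_irr : irreflexive adj
}.
Arguments adj {s}.

Definition graph_iso (G H : sgraph) : Prop :=
  exists2 f : G -> H, bijective f & forall x y, adj (f x) (f y) = adj x y.

Section Induced.
Variables (G : sgraph) (S : {set G}).

Definition induced_adj : rel {x : G | x \in S} :=
  fun u v => adj (val u) (val v).

Lemma induced_adj_sym : symmetric induced_adj.
Proof. by move=> u v; apply: adj_sym. Qed.

Lemma induced_adj_irr : irreflexive induced_adj.
Proof. by move=> u; apply: adj_irr. Qed.

Definition induced : sgraph := SGraph induced_adj_sym induced_adj_irr.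
End Induced.

Section CompleteBipartite.
Variables m n : nat.

Definition Kmn_adj : rel ('I_m + 'I_n) :=
  fun x y => match x, y with
  | inl _, inr _ | inr _, inl _ => true
  | _, _ => false
  end.

Lemma Kmn_adj_sym : symmetric Kmn_adj.
Proof. by move=> [x|x] [y|y]. Qed.

Lemma Kmn_adj_irr : irreflexive Kmn_adj.
Proof. by move=> [x|x]. Qed.

Definition Kmn : sgraph := SGraph Kmn_adj_sym Kmn_adj_irr.
End CompleteBipartite.

Definition claw_free (G : sgraph) : Prop :=
  forall S : {set G}, ~ graph_iso (induced S) (Kmn 1 3).

Definition connected (G : sgraph) : Prop :=
  forall x y : G, connect adj x y.

Definition k_connected (k : nat) (G : sgraph) : Prop :=
  k < #|G| /\ forall X : {set G}, #|X| < k -> connected (induced (~: X)).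

(* A cycle of a simple graph has at least three vertices; [ucycle] alone would
   also accept a single edge traversed back and forth. *)
Definition hamiltonian (G : sgraph) : Prop :=
  exists c : seq G, [/\ ucycle adj c, 2 < size c & forall x, x \in c].

Definition adjacency (R : realType) (G : sgraph) : 'M[R]_#|G| :=
  \matrix_(i, j) (adj (enum_val i) (enum_val j))%:R%R.

(* The adjacency matrix is real symmetric, so for a nonempty graph its real
   eigenvalues are a nonempty finite set and the supremum is their maximum. *)
Definition spectral_radius (R : realType) (G : sgraph) : R :=
  sup [set x : R | eigenvalue (adjacency R G) x]%classic.

Section EP.
Variable n : nat.

(* [inl u] ranges over the clique Q, whose vertices u = 0, 1, 2 are the
   distinguished ones; [inr (inl i)] is the triangle vertex b_i and
   [inr (inr i)] the degree-two vertex c_i, with indices i shifted to start at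
   0. As [n - 6] is truncated, this is the intended graph only for n >= 9. *)
Definition EP_adj : rel ('I_(n - 6) + ('I_3 + 'I_3)) :=
  fun x y => match x, y with
  | inl u, inl v => u != v
  | inl u, inr (inl i) | inr (inl i), inl u => u == i :> nat
  | inl u, inr (inr i) | inr (inr i), inl u => u == i :> nat
  | inr (inl i), inr (inl j) => i != j
  | inr (inl i), inr (inr j) | inr (inr j), inr (inl i) => i == j
  | inr (inr _), inr (inr _) => false
  end.

Lemma EP_adj_sym : symmetric EP_adj.
Proof. by move=> [u|[i|i]] [v|[j|j]] //=; rewrite eq_sym. Qed.

Lemma EP_adj_irr : irreflexive EP_adj.
Proof. by move=> [u|[i|i]] //=; rewrite eqxx. Qed.

Definition EP : sgraph := SGraph EP_adj_sym EP_adj_irr.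
End EP.

(* Main.v *)
(** Suppose [G] is not Hamiltonian. Ryjacek's closure, obtained here by adding
    edges one at a time inside neighbourhoods, embeds [G] in a claw-free
    non-Hamiltonian graph without induced diamond, in which every neighbourhood
    is a union of at most two disjoint cliques. Let [y] be the absolute value of
    an eigenvector of [G] for its spectral radius, which is at least the spectral
    radius [rho > n - 7] of [EP_n]. At a maximum [v] of [y] the degrees of the
    neighbours of [v] sum to at least [rho ^ 2], and for [n >= 33] this forces a
    clique [K] missing at most six vertices. A Hamilton cycle exists as soon as
    the vertices outside [K] are covered by disjoint paths with both ends in [K];
    taking a system of such paths that covers as much as possible, 2-connectedness
    and claw-freeness leave only two shapes with exactly six outside vertices.
    The first one is a spanning subgraph of [EP_n], and pairing [y] with the
    positive eigenvector of [EP_n] shows that [G] is [EP_n]. The second one carries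
    a positive vector that its adjacency matrix sends strictly below its multiple
    by [rho], which excludes [y]. *)

Require Import Defs.
From mathcomp Require Import all_boot all_order all_algebra.
From mathcomp Require Import classical_sets reals.
From mathcomp Require Import zify ring lra.

Set Implicit Arguments.
Unset Strict Implicit.
Unset Printing Implicit Defensive.

(** * Hamilton cycles and edge additions *)

(** Adding edges destroys an eigenvector equation, so only the inequality
    [rho * y v <= \sum_(u | e v u) y u] is kept, for a nonnegative nonzero [y]: it survives in every
    larger graph. Edges are added by Bondy-Chvatal arguments: a Hamilton cycle through a new edge
    [x y] leaves a Hamilton path from [x] to [y], to be closed up differently. The obstacle is a
    pair of neighbours of [z] without common neighbour in [N(z)]; it needs a second rule with three
    centres, applicable once all other pairs are joined. The bound 33 comes from the degree sum.
    With [s] vertices outside [K] it is at most [(n - 1 - s)^2 + s^2] in the main range, and for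
    [s = 7] this is below [(n - 7)^2] exactly when [2n - 15 > 49]. [rho] is constructed as a root of
    an explicit quartic with a positive eigenvector of [EP_n]; about the spectral radius of [EP_n]
    only [rho <= mu(EP_n)] is used. The two shapes are found in the closure, yet the conclusion
    concerns [G]: it lies in the closure, which lies in [EP_n], and rigidity is applied to [G]
    inside [EP_n]. *)

Section Walks.
Variables (T : finType) (e : rel T).

(** The list contains both of its ends, so that walks can be reversed and concatenated
    symmetrically. *)
Definition walk (s : seq T) (x y : T) : bool :=
  if s is a :: p then [&& a == x, path e a p & last a p == y] else false.

(** [hamiltonian] for a bare relation, because edges are added to relations and not to an
    [sgraph]. *)
Definition ham : Prop :=
  exists c : seq T, [/\ ucycle e c, 2 < size c & forall x, x \in c].

Definition spanning (s : seq T) := perm_eq s (enum T).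

Lemma walk1 x : walk [:: x] x x.
Proof. by rewrite /walk /= !eqxx. Qed.

Lemma walk1E c x y : walk [:: c] x y -> x = c /\ y = c.
Proof. by move=> /= /andP[/eqP-> /eqP->]. Qed.

Lemma walk_cat A B x u v y :
  walk A x u -> e u v -> walk B v y -> walk (A ++ B) x y.
Proof.
case: A B => [|a A] [|b B] // /and3P[ax pA /eqP lA] uv /and3P[/eqP bv pB lB].
by rewrite /walk /= ax cat_path pA /= lA bv uv -bv pB last_cat /= lB.
Qed.

Lemma walk_cons a B x v y :
  x = a -> e a v -> walk B v y -> walk (a :: B) x y.
Proof. by move=> -> av wB; apply: (walk_cat (walk1 a) av wB). Qed.

Lemma walk_rcons A x u b : walk A x u -> e u b -> walk (rcons A b) x b.
Proof. by move=> wA ub; rewrite -cats1; apply: walk_cat wA ub (walk1 b). Qed.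

Lemma walk_cat_inv A B x y : walk (A ++ B) x y -> A != [::] -> B != [::] ->
  exists u v, [/\ walk A x u, e u v & walk B v y].
Proof.
case: A B => [|a A] [|b B] //= /and3P[-> + +] _ _.
rewrite cat_path last_cat /= => /and3P[-> ab ->] ->.
by exists (last a A), b; rewrite !eqxx.
Qed.

Lemma walk_head a A x y : walk (a :: A) x y -> a = x.
Proof. by case/and3P=> /eqP. Qed.

Lemma walk_last A b x y : walk (rcons A b) x y -> b = y.
Proof.
by case: A => [/andP[_ /eqP]|a A] //=; rewrite last_rcons => /and3P[_ _ /eqP].
Qed.

Lemma walk_headE A x y : walk A x y -> exists A', A = x :: A'.
Proof. by case: A => //= a A /and3P[/eqP-> _ _]; exists A. Qed.

Lemma walk_lastE A x y : walk A x y -> exists A', A = rcons A' y.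
Proof.
case: A => //= a A /and3P[_ _ /eqP <-].
by exists (belast a A); rewrite lastI.
Qed.

Hypothesis e_sym : symmetric e.

Lemma walk_rev A x y : walk A x y -> walk (rev A) y x.
Proof.
case: A => // a A /and3P[/eqP <- pA /eqP <-].
rewrite lastI rev_rcons /= eqxx rev_path.
rewrite (eq_path (e' := e)) ?pA /=; last by move=> u v; rewrite e_sym.
by case: A {pA} => //= b A; rewrite rev_cons last_rcons.
Qed.

Lemma ham_walk s x y :
  2 < #|T| -> walk s x y -> e y x -> spanning s -> ham.
Proof.
move=> T2 ws yx ps; exists s; split.
- rewrite /ucycle (perm_uniq ps) enum_uniq andbT.
  case: s ws {ps} => //= a s /and3P[/eqP-> ps /eqP ls].
  by rewrite rcons_path ps ls.
- by rewrite (perm_size ps) -cardE.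
- by move=> z; rewrite (perm_mem ps) mem_enum.
Qed.

End Walks.

Arguments walk : simpl never.

(** Two arrangements of the same pieces are compared by counting an arbitrary predicate, which
    leaves linear arithmetic. *)
Ltac count_perm H :=
  apply: (perm_trans _ H); apply/permP => ?;
  do 8 rewrite -?cats1 ?(count_cat, count_rev) /=;
  clear; lia.

Section EdgeAddition.
Variables (T : finType) (e : rel T).
Hypotheses (e_sym : symmetric e) (e_irr : irreflexive e).

Definition add_edge (x y : T) : rel T :=
  fun a b => [|| e a b, (a == x) && (b == y) | (a == y) && (b == x)].

Lemma ham_add_edge x y : ham (add_edge x y) ->
  ham e \/ 2 < #|T| /\ exists s, walk e s x y /\ spanning s.
Proof.
case=> c [/andP[cyc Uc] c2 allc].
have pc : perm_eq c (enum T).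
  by apply: uniq_perm; rewrite ?enum_uniq // => z; rewrite mem_enum allc.
have T2 : 2 < #|T| by rewrite cardE -(perm_size pc).
have [h|/allPn[v _ nvw]] := boolP (all (fun v => e v (next c v)) (enum T)).
  left; exists c; split=> //; rewrite /ucycle Uc andbT.
  by apply: cycle_from_next => // v _; apply: (allP h); rewrite mem_enum.
right; split=> //.
set w := next c v in nvw.
have e'vw : add_edge x y v w by apply: (next_cycle cyc); apply: allc.
have [i c' rotc] := rot_to (allc w).
have cyc' : cycle (add_edge x y) (w :: c') by rewrite -rotc rot_cycle.
have Uc' : uniq (w :: c') by rewrite -rotc rot_uniq.
have lastv : last w c' = v.
  have := prev_next Uc v; rewrite -/w -(prev_rot i Uc) rotc prev_nth mem_head.
  rewrite memNindex; last by case/andP: Uc'.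
  by rewrite -last_nth.
have sz : 2 < size (w :: c') by rewrite -rotc size_rot.
have pc' : spanning (w :: c').
  apply: uniq_perm; rewrite ?enum_uniq // => z.
  by rewrite mem_enum -rotc mem_rot allc.
have vw : (v == x) && (w == y) || (v == y) && (w == x).
  by move: e'vw nvw; rewrite /add_edge; case: (e v w).
have pw : path e w c'.
  case/lastP: c' lastv sz Uc' cyc' {rotc pc'} => // q b; rewrite last_rcons => -> {b}.
  rewrite [size _]/= size_rcons; case: q => // t q _.
  rewrite /= !rcons_path last_rcons rcons_uniq !inE !mem_rcons !inE !negb_or.
  case/and4P=> /and3P[/eqP wt /eqP wv wq] /andP[/eqP tv _] _ _.
  case/and3P=> wt' ptq _.
  (* Only the pair [v], [w] can be a new edge. The first step of the path avoids [v] and all later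
     ones avoid [w]. *)
  have add_e a b : (a <> w /\ b <> w) \/ (a <> v /\ b <> v) ->
      add_edge x y a b -> e a b.
    move=> ab /or3P[] // /andP[/eqP ax /eqP bx];
    by case/orP: vw => /andP[/eqP vx /eqP wx]; intuition congruence.
  rewrite add_e //=; last by right; split=> // /esym.
  rewrite -!rcons_path in ptq *.
  apply: (sub_in_path (P := predC1 w)) ptq => [a b|] /=.
    by rewrite !inE => /eqP aw /eqP bw; apply: add_e; left.
  rewrite all_rcons /= eq_sym (introN eqP wt) eq_sym (introN eqP wv) /=.
  by apply/allP => a aq; rewrite inE; apply: contraNneq wq => <-.
case/orP: vw => /andP[/eqP vE /eqP wE]; last first.
  exists (w :: c'); split=> //; rewrite /walk -wE -vE -lastv !eqxx pw //.
exists (rev (w :: c')); split; last first.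
  by rewrite /spanning perm_rev.
by apply: walk_rev => //; rewrite /walk -wE -vE -lastv !eqxx pw.
Qed.
End EdgeAddition.

(** * Single edges whose addition creates no Hamilton cycle *)

Section EdgeClosure.
Variables (T : finType) (e : rel T).
Hypotheses (e_sym : symmetric e) (e_irr : irreflexive e) (T2 : 2 < #|T|).

Lemma walk_cut A c B x y : walk e (A ++ c :: B) x y ->
  walk e (rcons A c) x c /\ walk e (c :: B) c y.
Proof.
case: A => [|a A] ws.
  by move: (ws); rewrite (walk_head ws) /walk /= !eqxx.
have [u [v [wA uv wB]]] := @walk_cat_inv _ _ (a :: A) (c :: B) x y ws isT isT.
have vE := walk_head wB; rewrite -vE in uv wB; split=> //.
exact: walk_rcons wA uv.
Qed.

Lemma walk_uncons c w B x y : walk e (c :: w :: B) x y ->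
  e c w /\ walk e (w :: B) w y.
Proof. by rewrite /walk /= eqxx => /and3P[_ /andP[-> ->] ->]. Qed.

Lemma spanning_rev (s : seq T) : spanning s -> spanning (rev s).
Proof. by rewrite /spanning perm_rev. Qed.

Lemma spanning_uniq (s : seq T) : spanning s -> uniq s.
Proof. by move/perm_uniq->; rewrite enum_uniq. Qed.

Lemma edge_neq x y : e x y -> x != y.
Proof. by apply: contraTneq => ->; rewrite e_irr. Qed.

Lemma walk_mem_head A c B x y : walk e (A ++ c :: B) x y -> c != x -> x \in A.
Proof.
case: A => [|a A] w; first by rewrite (walk_head w) eqxx.
by rewrite -(walk_head w) mem_head.
Qed.

Lemma walk_mem_last A c B x y : walk e (A ++ c :: B) x y -> c != y -> y \in B.
Proof.
move/(walk_rev e_sym); rewrite rev_cat rev_cons cat_rcons => /walk_mem_head h /h.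
by rewrite mem_rev.
Qed.

(** Crossing chords: [x..c], then [y..w] backwards, then [w x]. *)
Lemma ham_succ A c w B x y :
  walk e (A ++ c :: w :: B) x y -> spanning (A ++ c :: w :: B) ->
  e c y -> e x w -> ham e.
Proof.
move=> ws sp cy xw; have [wA wB] := walk_cut ws; have [_ {}wB] := walk_uncons wB.
apply: (@ham_walk _ _ (rcons A c ++ rev (w :: B)) x w) => //; last by count_perm sp.
  exact: walk_cat wA cy (walk_rev e_sym wB).
by rewrite e_sym.
Qed.

Lemma ham_pred A w c B x y :
  walk e (A ++ w :: c :: B) x y -> spanning (A ++ w :: c :: B) ->
  e c x -> e y w -> ham e.
Proof.
move=> ws sp cx yw; have E : rev (A ++ w :: c :: B) = rev B ++ c :: w :: rev A.
  by rewrite rev_cat !rev_cons !cat_rcons.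
apply: (@ham_succ (rev B) c w (rev A) y x) => //; rewrite -E.
  exact: walk_rev.
exact: spanning_rev.
Qed.

(** Let [M] run from [m] to [k]. Crossing chords settle everything except [m] adjacent to [y] and
    [k] adjacent to [x]; then [m..k], [x..u], [v..y], back to [m] is a cycle, using the edge
    [u v]. *)
Lemma ham_two_centers A u M v D x y :
  walk e (A ++ u :: M ++ v :: D) x y -> spanning (A ++ u :: M ++ v :: D) ->
  e u v -> e u y -> e v x ->
  (forall w M', M = w :: M' -> e x w || e y w) ->
  (forall w M', M = rcons M' w -> e x w || e y w) -> ham e.
Proof.
case: M => [|m M] ws sp uv uy vx gm gk.
  by apply: (ham_succ ws sp) => //; rewrite e_sym.
have /orP[xm|ym] := gm m M erefl; first exact: (ham_succ ws sp).
have [wA] := walk_cut ws; rewrite cat_cons => /walk_uncons[um].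
rewrite -cat_cons => /walk_cat_inv[] // k [v' [wM]].
have [M' EM] := walk_lastE wM; rewrite EM in gk.
have /orP[xk|yk] := gk k M' erefl; last first.
  move=> _ _; apply: (@ham_pred (A ++ u :: M') k v D x y) => //; move: ws sp;
  by rewrite EM -cats1 -?catA /= -?catA.
move=> kv wD; have vE := walk_head wD; rewrite -vE in kv wD.
apply: (@ham_walk _ _ ((m :: M) ++ (rcons A u ++ v :: D)) m y) => //; last first.
  by count_perm sp.
apply: walk_cat wM _ (walk_cat wA uv wD).
by rewrite e_sym.
Qed.

Lemma spanning_walk_mid A u M v D x y w :
  walk e (A ++ u :: M ++ v :: D) x y -> spanning (A ++ u :: M ++ v :: D) ->
  u != x -> v != y -> w \in M -> (w != x) && (w != y).
Proof.
move=> ws /spanning_uniq Us ux vy wM.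
have xA := walk_mem_head ws ux.
have yD : y \in D.
  by move: ws; rewrite -cat_cons catA => /walk_mem_last; apply.
move: Us; rewrite cat_uniq => /and3P[_ dA]; rewrite /= => /andP[_].
rewrite cat_uniq => /and3P[_ dM _]; apply/andP; split.
  apply: contraNneq dA => wx; apply/hasP; exists x => //.
  by rewrite inE mem_cat -wx wM orbT.
by apply: contraNneq dM => wy; apply/hasP; exists y; rewrite ?inE -?wy ?yD ?orbT // wy yD orbT.
Qed.

Definition near x y w := [|| w == x, w == y, e x w | e y w].

(* Broersma's K4-closure. *)
Lemma ham_add_edge_K4 x y u v :
  e u v -> e u x -> e u y -> e v x -> e v y ->
  (forall w, e u w || e v w -> near x y w) ->
  ham (add_edge e x y) -> ham e.
Proof.
move=> uv ux uy vx vy good /(ham_add_edge e_sym)[] // [_ [s [ws sp]]].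
wlog [A [M [D sE]]] : u v uv ux uy vx vy good / exists A M D, s = A ++ u :: M ++ v :: D.
  move=> th; have us : u \in s by rewrite (perm_mem sp) mem_enum.
  have : v \in s by rewrite (perm_mem sp) mem_enum.
  case/splitPr: us ws sp th => A B ws sp th.
  rewrite mem_cat inE => /or3P[vA|/eqP E|vB].
  - apply: (th v u) => // [|w|]; first by rewrite e_sym.
      by rewrite orbC; apply: good.
    case/splitPr: vA => A' B'; exists A', B', B.
    by rewrite -catA cat_cons.
  - by rewrite E e_irr in uv.
  - apply: (th u v) => //; case/splitPr: vB => A' B'; by exists A, A', B'.
rewrite {}sE in ws sp.
have gM w : w \in M -> e u w || e v w -> e x w || e y w.
  move=> wM /good; have := spanning_walk_mid ws sp (edge_neq ux) (edge_neq vy) wM.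
  by rewrite /near; do 2 case: eqP => //.
apply: (ham_two_centers ws sp) => // w M' EM; apply: gM; rewrite ?EM ?mem_head //.
- by have [_] := walk_cut ws; rewrite EM => /walk_uncons[-> _].
- by rewrite mem_rcons mem_head.
- have : walk e ((A ++ u :: M') ++ w :: v :: D) x y.
    by move: ws; rewrite EM -cats1 -?catA /= -?catA.
  by case/walk_cut=> _ /walk_uncons[wv _]; rewrite (e_sym v) wv orbT.
Qed.

(* The situation of two neighbours [x], [y] of [z] at distance 3 in a claw-free
   [N(z)], joined by the path [x p q y], once all pairs of [N(z)] at distance 2
   have been made adjacent: vertices near neither [x] nor [y] are possible, but
   they see both [p] and [q] and form a clique. *)
Definition K5_config (x y z p q : T) :=
  [/\ [/\ e z x, e z y, e p x & e p y] /\ [/\ e q x, e q y, e z p, e z q & e p q],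
      forall w, e z w -> near x y w,
      forall w, e p w -> ~~ near x y w -> e q w,
      forall w, e q w -> ~~ near x y w -> e p w &
      forall w w', w != w' -> e p w -> e p w' ->
        ~~ near x y w -> ~~ near x y w' -> e w w'].

Lemma near_sym x y w : near x y w = near y x w.
Proof. by rewrite /near; case: (w == x); case: (w == y); case: (e x w); case: (e y w). Qed.

Lemma K5_config_swap x y z p q : K5_config x y z p q -> K5_config x y z q p.
Proof.
case=> [[[zx zy px py] [qx qy zp zq pq]] Cz Cp Cq Cc]; split=> //.
  by rewrite (e_sym q p).
by move=> w w' ww' qw qw' gw gw'; apply: Cc => //; apply: Cq.
Qed.

Lemma K5_config_flip x y z p q : K5_config x y z p q -> K5_config y x z p q.
Proof.
case=> [[[zx zy px py] [qx qy zp zq pq]] Cz Cp Cq Cc]; split=> // *.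
- by rewrite near_sym; apply: Cz.
- by apply: Cp; rewrite // near_sym.
- by apply: Cq; rewrite // near_sym.
- by apply: Cc; rewrite // near_sym.
Qed.

(** [p] and [z] act as two centres. The predecessor of [z] is always near, so the only obstruction
    is a successor of [p] near neither end, and such a vertex also sees [q]. *)
Lemma K5_succ x y z p q A M B : K5_config x y z p q ->
  walk e (A ++ p :: M ++ z :: B) x y -> spanning (A ++ p :: M ++ z :: B) ->
  ham e \/ exists w M', [/\ M = w :: M', e p w, e q w & ~~ near x y w].
Proof.
case=> [[[zx zy px py] [qx qy zp zq pq]] Cz Cp Cq Cc] ws sp.
have gM w : w \in M -> near x y w -> e x w || e y w.
  have := spanning_walk_mid ws sp (edge_neq px) (edge_neq zy).
  by rewrite /near => h /h; do 2 case: eqP => //.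
have gz w M' : M = rcons M' w -> e x w || e y w.
  move=> EM; apply: gM; rewrite ?EM ?mem_rcons ?mem_head //; apply: Cz.
  have : walk e ((A ++ p :: M') ++ w :: z :: B) x y.
    by move: ws; rewrite EM -cats1 -?catA /= -?catA.
  by case/walk_cut=> _ /walk_uncons[wz _]; rewrite e_sym.
case: M ws sp gM gz => [|m M] ws sp gM gz.
  by left; apply: (ham_succ ws sp) => //; rewrite e_sym.
have pm : e p m by have [_ /walk_uncons[]] := walk_cut ws.
have [nm|nm] := boolP (near x y m); last by right; exists m, M; split; auto.
left; apply: (ham_two_centers ws sp) => //; first by rewrite e_sym.
by move=> w M' [<- _]; apply: gM; rewrite ?mem_head.
Qed.

Lemma K5_pred x y z p q A M B : K5_config x y z p q ->
  walk e (A ++ z :: M ++ p :: B) x y -> spanning (A ++ z :: M ++ p :: B) ->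
  ham e \/ exists w M', [/\ M = rcons M' w, e p w, e q w & ~~ near x y w].
Proof.
move=> cfg ws sp.
have E : rev (A ++ z :: M ++ p :: B) = rev B ++ p :: rev M ++ z :: rev A.
  by rewrite !(rev_cat, rev_cons) -!cats1 -?catA /= -?catA.
have := K5_succ (K5_config_flip cfg) (A := rev B) (M := rev M) (B := rev A).
rewrite -E => /(_ (walk_rev e_sym ws) (spanning_rev sp)) [|[w [M' [EM pw qw nw]]]].
  by left.
right; exists w, (rev M'); split=> //; last by rewrite near_sym.
by rewrite -[M]revK EM rev_cons.
Qed.

(** The cycle is [x..p], [y..w'] backwards, [w..k], [q], back to [x], where [k] precedes [q]. *)
Lemma ham_two_before A p w B q w' C x y :
  walk e (A ++ p :: (w :: B) ++ q :: w' :: C) x y ->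
  spanning (A ++ p :: (w :: B) ++ q :: w' :: C) ->
  e p q -> e p y -> e q x -> e w w' -> ham e.
Proof.
move=> ws sp pq py qx ww'.
have [wA /walk_uncons[pw wB]] := walk_cut ws.
have {wB} : walk e ((w :: B) ++ q :: w' :: C) w y by [].
move=> /walk_cut[]; rewrite -cats1 => /walk_cat_inv[] // k [q' [wB kq]].
move=> /walk1E[qE _]; rewrite qE in kq => /walk_uncons[qw' wC].
apply: (@ham_walk _ _ (rcons A p ++ rev (q :: rev (w :: B) ++ w' :: C)) x q) => //.
  apply: walk_cat wA py _; apply: walk_rev => //.
  apply: (@walk_cons _ _ _ _ _ k) => //; first by rewrite e_sym.
  exact: walk_cat (walk_rev e_sym wB) ww' wC.
by count_perm sp.
Qed.

(** The cycle is [x..p], [D] backwards from [w'] to [d], [y..q] backwards, [w..k], [z], back to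
    [x]. *)
Lemma ham_around A p W z D q E x y w d w' k :
  walk e (A ++ p :: W ++ z :: D ++ q :: E) x y ->
  spanning (A ++ p :: W ++ z :: D ++ q :: E) ->
  walk e W w k -> walk e D d w' ->
  e p w' -> e d y -> e q w -> e z x -> ham e.
Proof.
move=> ws sp wW wD pw' dy qw zx.
have [wA] := walk_cut ws; rewrite -cat_cons => /walk_cut[wz].
rewrite -cat_cons => /walk_cut[_ wE].
have kz : e k z.
  have {wz} : walk e ((p :: W) ++ [:: z]) p z by rewrite cats1.
  case/walk_cat_inv=> // k' [z' [wk' kz /walk1E[zE _]]]; rewrite zE in kz.
  have [W' WE] := walk_lastE wW.
  by move: wk'; rewrite WE -rcons_cons => /walk_last->.
apply: (@ham_walk _ _ (rcons A p ++ rev D ++ rev (q :: E) ++ rcons W z) x z) => //.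
- apply: walk_cat wA pw' _; apply: (walk_cat (walk_rev e_sym wD) dy).
  apply: (walk_cat (walk_rev e_sym wE) qw); exact: walk_rcons wW kz.
- by count_perm sp.
Qed.

Lemma walk_infix A B C x y : walk e (A ++ B ++ C) x y -> B != [::] ->
  exists u v, walk e B u v.
Proof.
move=> ws B0.
have {ws} [u [v wBC]] : exists u v, walk e (B ++ C) u v.
  case: A ws => [|a A] ws; first by exists x, y.
  have [|_ [v [_ _ wv]]] := @walk_cat_inv _ _ (a :: A) (B ++ C) x y ws isT.
    by case: (B) B0.
  by exists v, y.
case: C wBC => [|c C]; first by rewrite cats0; exists u, v.
by move/walk_cat_inv => /(_ B0 isT)[w [? [wB _ _]]]; exists u, w.
Qed.

(** The obstructing successors [w] of [p] and [w'] of [q] are both far from [x] and [y], hence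
    adjacent to each other. *)
Lemma K5_before x y z p q A M N B s :
  s = A ++ p :: M ++ q :: N ++ z :: B ->
  K5_config x y z p q -> walk e s x y -> spanning s -> ham e.
Proof.
move=> E cfg ws sp.
have E1 : s = A ++ p :: (M ++ q :: N) ++ z :: B by rewrite E -catA.
have E2 : s = (A ++ p :: M) ++ q :: N ++ z :: B by rewrite E -catA.
move: (ws) (sp); rewrite {1 2}E1 => ws1 sp1.
have [//|[w [M' [EM pw qw nw]]]] := K5_succ cfg ws1 sp1.
move: (ws) (sp); rewrite {1 2}E2 => ws2 sp2.
have [//|[w' [N' [EN qw' pw' nw']]]] := K5_succ (K5_config_swap cfg) ws2 sp2.
case: cfg => [[[zx zy px py] [qx qy zp zq pq]] Cz Cp Cq Cc].
case: M EM E {E1 E2 ws1 sp1 ws2 sp2} => [|m M] /= [mE _] E.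
  by case/negP: nw; rewrite -mE /near e_sym qx !orbT.
rewrite {}E {}mE {}EN in ws sp; apply: (ham_two_before ws sp) => //.
apply: Cc => //; have := spanning_uniq sp.
rewrite cat_uniq => /and3P[_ _] /= /and3P[_ + _].
by rewrite mem_cat !inE !negb_or => /and4P[_ _ ? _].
Qed.

(** The obstructions are now the successor of [p] and the predecessor of [q], each seen by both [p]
    and [q]. The successor [d] of [z] is near: the edge [x d] gives crossing chords, the edge [y d]
    gives the cycle of [ham_around]. *)
Lemma K5_between x y z p q A M N B s :
  s = A ++ p :: M ++ z :: N ++ q :: B ->
  K5_config x y z p q -> walk e s x y -> spanning s -> ham e.
Proof.
move=> E cfg ws sp.
have E2 : s = (A ++ p :: M) ++ z :: N ++ q :: B by rewrite E -catA.
move: (ws) (sp); rewrite {1 2}E => ws1 sp1.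
have [//|[w [M' [EM pw qw nw]]]] := K5_succ cfg ws1 sp1.
move: (ws) (sp); rewrite {1 2}E2 => ws2 sp2.
have [//|[w' [N' [EN qw' pw' nw']]]] := K5_pred (K5_config_swap cfg) ws2 sp2.
case: cfg => [[[zx zy px py] [qx qy zp zq pq]] Cz Cp Cq Cc].
have [w1 [k wM]] : exists u v, walk e M u v.
  apply: (@walk_infix (rcons A p) M (z :: N ++ q :: B) x y); last by rewrite EM.
  by rewrite cat_rcons.
have [d [w2 wN]] : exists u v, walk e N u v.
  apply: (@walk_infix (A ++ p :: rcons M z) N (q :: B) x y).
    by rewrite -catA /= cat_rcons.
  by rewrite EN; case: (N').
have w1E : w1 = w by move: wM; rewrite EM => /walk_head.
have w2E : w2 = w' by move: wN; rewrite EN => /walk_last.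
have [N2 EN2] := walk_headE wN.
have dN : d \in N by rewrite EN2 mem_head.
have /andP[/negbTE dx /negbTE dy] :=
  spanning_walk_mid ws2 sp2 (edge_neq zx) (edge_neq qy) dN.
have zd : e z d.
  by move: ws2; rewrite EN2 => /walk_cut[_ /walk_uncons[]].
have := Cz d zd; rewrite /near dx dy /= => /orP[xd|yd].
  by rewrite EN2 in ws2 sp2; apply: (ham_succ ws2 sp2).
rewrite w1E in wM; rewrite w2E in wN.
by apply: (ham_around ws1 sp1 wM wN) => //; rewrite e_sym.
Qed.

Lemma K5_both_before x y z p q S1 S2 : K5_config x y z p q ->
  walk e (S1 ++ z :: S2) x y -> spanning (S1 ++ z :: S2) ->
  p \in S1 -> q \in S1 -> ham e.
Proof.
move=> cfg ws sp pS; case/splitPr: pS ws sp => A B ws sp.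
rewrite mem_cat inE => /or3P[qA|/eqP qp|qB].
- case/splitPr: qA ws sp => A' B' ws sp.
  apply: (K5_before _ (K5_config_swap cfg) ws sp).
  by rewrite -?catA /= -?catA.
- by case: cfg => [[_ [_ _ _ _]]]; rewrite qp e_irr.
- case/splitPr: qB ws sp => A' B' ws sp.
  by apply: (K5_before _ cfg ws sp); rewrite -?catA /= -?catA.
Qed.

Lemma ham_add_edge_K5 x y z p q : K5_config x y z p q ->
  ham (add_edge e x y) -> ham e.
Proof.
move=> cfg /(ham_add_edge e_sym)[] // [_ [s [ws sp]]].
have all_s w : w \in s by rewrite (perm_mem sp) mem_enum.
have [[_ [_ _ /edge_neq zp /edge_neq zq _]] _ _ _ _] := cfg.
case/splitPr: {all_s}(all_s z) (all_s) ws sp => S1 S2 all_s ws sp.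
have : p \in S1 ++ z :: S2 by apply: all_s.
have : q \in S1 ++ z :: S2 by apply: all_s.
rewrite !mem_cat !inE ![_ == z]eq_sym (negbTE zp) (negbTE zq) /=.
have between p' q' : K5_config x y z p' q' -> p' \in S1 -> q' \in S2 -> ham e.
  move=> cfg' p1 q2; case/splitPr: p1 q2 ws sp => A B q2; case/splitPr: q2 => C D ws sp.
  by apply: (K5_between _ cfg' ws sp); rewrite -?catA /= -?catA.
case/orP=> qs /orP[] ps.
- exact: K5_both_before ws sp ps qs.
- exact: (between q p (K5_config_swap cfg)).
- exact: (between p q).
- have E : rev (S1 ++ z :: S2) = rev S2 ++ z :: rev S1.
    by rewrite rev_cat rev_cons cat_rcons.
  apply: (@K5_both_before y x z p q (rev S2) (rev S1)); rewrite ?mem_rev -?E //.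
  + exact: K5_config_flip.
  + exact: walk_rev.
  + exact: spanning_rev.
Qed.

End EdgeClosure.

(** * Local completion *)

Section Completion.
Variables (T : finType).
Implicit Type e : rel T.

Definition clawfree e := forall c x y z, e c x -> e c y -> e c z ->
  x != y -> x != z -> y != z -> [|| e x y, e x z | e y z].

Definition completion e (z : T) : rel T := fun a b =>
  e a b || [&& a != b, (a == z) || e z a & (b == z) || e z b].

Lemma completion_sym e z : symmetric e -> symmetric (completion e z).
Proof.
by move=> e_sym a b; rewrite /completion e_sym eq_sym; congr (_ || (_ && _)); rewrite andbC.
Qed.

Lemma completion_irr e z : irreflexive e -> irreflexive (completion e z).
Proof. by move=> e_irr a; rewrite /completion e_irr eqxx. Qed.

Lemma ham_eq e e' : e =2 e' -> ham e -> ham e'.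
Proof.
by move=> ee' [c [Hc *]]; exists c; split=> //; move: Hc; rewrite /ucycle (eq_cycle ee').
Qed.

Lemma ham_card e : ham e -> 2 < #|T|.
Proof.
case=> c [/andP[_ Uc] c2 _]; apply: leq_trans c2 _.
by rewrite -(card_uniqP Uc) max_card.
Qed.

Lemma add_edge_sym e x y : symmetric e -> symmetric (add_edge e x y).
Proof.
move=> e_sym a b; rewrite /add_edge e_sym; congr (_ || _).
by rewrite orbC andbC [X in _ || X]andbC.
Qed.

Lemma add_edge_irr e x y : irreflexive e -> x != y -> irreflexive (add_edge e x y).
Proof.
move=> e_irr xy a; rewrite /add_edge e_irr /=; apply/negbTE.
by apply: contra xy => /orP[]/andP[/eqP<- /eqP->].
Qed.

(** For [c] in the closed neighbourhood [K] of [z], its neighbours inside [K] now form a clique, and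
    so do those outside [K], by the old claw condition at [c] with [z] as third leg. Two cliques
    leave no room for a claw. For [c] outside [K] the neighbourhood is unchanged. *)
Lemma clawfree_completion e z :
  symmetric e -> irreflexive e -> clawfree e -> clawfree (completion e z).
Proof.
move=> e_sym e_irr cf.
pose K := [pred a | (a == z) || e z a].
have compK a b : completion e z a b = e a b || [&& a != b, a \in K & b \in K] by [].
have notK c a : c \in K -> completion e z c a -> a \notin K -> c != z /\ e c a.
  move=> cK; rewrite compK => + aK; rewrite (negbTE aK) !andbF orbF => ca.
  split=> //; apply: contraNneq aK => cz; by rewrite inE -cz ca orbT.
have inK a b : a != b -> a \in K -> b \in K -> completion e z a b.
  by move=> ab aK bK; rewrite compK ab aK bK orbT.
have outK c a b : c \in K -> completion e z c a -> completion e z c b -> a != b ->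
    a \notin K -> b \notin K -> completion e z a b.
  move=> cK ca cb ab aK bK; have [cz {}ca] := notK _ _ cK ca aK.
  have [_ {}cb] := notK _ _ cK cb bK.
  have zc : e z c by move: cK; rewrite inE (negbTE cz).
  move: aK bK; rewrite !inE !negb_or => /andP[az nza] /andP[bz nzb].
  have := cf c z a b; rewrite [e c z]e_sym zc ca cb ab ![z == _]eq_sym az bz.
  rewrite (negbTE nza) (negbTE nzb) => /(_ isT isT isT isT isT isT) /= ab'.
  by rewrite compK ab'.
move=> c x y w cx cy cw xy xw yw.
have [cK|cK] := boolP (c \in K).
  have [xK|xK] := boolP (x \in K); have [yK|yK] := boolP (y \in K).
  - by rewrite (inK _ _ xy).
  - have [wK|wK] := boolP (w \in K); first by rewrite (inK _ _ xw) ?orbT.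
    by rewrite (outK _ _ _ cK cy cw) ?orbT.
  - have [wK|wK] := boolP (w \in K); first by rewrite (inK _ _ yw) ?orbT.
    by rewrite (outK _ _ _ cK cx cw) ?orbT.
  - by rewrite (outK _ _ _ cK cx cy).
have cE a : completion e z c a = e c a by rewrite compK (negbTE cK) /= andbF orbF.
rewrite !cE in cx cy cw.
by have /or3P[h|h|h] := cf c x y w cx cy cw xy xw yw; rewrite !compK h ?orbT.
Qed.

Section NonhamCompletion.
Variables (e : rel T) (z u0 x0 y0 : T).
Hypotheses (e_sym : symmetric e) (e_irr : irreflexive e) (cf : clawfree e).
Hypotheses (zu0 : e z u0) (zx0 : e z x0) (zy0 : e z y0) (ux0 : e u0 x0) (uy0 : e u0 y0).
Hypotheses (nxy0 : x0 != y0) (nexy0 : ~~ e x0 y0).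

Lemma center_near x y w : e z x -> e z y -> e z w -> x != y -> ~~ e x y -> near e x y w.
Proof.
move=> zx zy zw xy nxy; rewrite /near; have [//|wx] := eqVneq w x.
have [//|wy] := eqVneq w y.
have := cf zx zy zw xy; rewrite [x == w]eq_sym [y == w]eq_sym (negbTE nxy).
exact.
Qed.

Section Intermediate.
Variable h : rel T.
Hypotheses (h_sym : symmetric h) (h_irr : irreflexive h).
Hypotheses (sub_eh : subrel e h) (sub_hc : subrel h (completion e z)).

Lemma new_edge_in_nbhd a b : h a b -> ~~ e a b -> (a == z) || e z a /\ (b == z) || e z b.
Proof. by move/sub_hc => /orP[-> //|/and3P[_ -> ->]]. Qed.

Lemma near_sub x y w : near e x y w -> near h x y w.
Proof.
by rewrite /near => /or4P[->|->|/sub_eh->|/sub_eh->]; rewrite ?orbT.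
Qed.

Section Missing.
Variables x y : T.
Hypotheses (xy : x != y) (nhxy : ~~ h x y) (zx : e z x) (zy : e z y).

Let nexy : ~~ e x y. Proof. by apply: contra nhxy; apply: sub_eh. Qed.

Lemma nbr_z_near w : (w == z) || e z w -> near h x y w.
Proof.
case/predU1P=> [->|zw]; first by rewrite /near ![h _ z]h_sym !sub_eh ?orbT.
exact: near_sub (center_near zx zy zw xy nexy).
Qed.

Lemma center_nbr w : h z w -> e z w.
Proof.
move/sub_hc => /orP[//|/and3P[zw _]]; by rewrite eq_sym (negbTE zw).
Qed.

(** [z] and [v] are the two centres of the K4 rule. Claw-freeness is available for [e] only: a
    neighbour of [v] through an edge of [e] is near by the claw condition at [v], and one through a
    new edge lies in the closed neighbourhood of [z], where the claw condition at [z] applies. *)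
Lemma ham_add_distance2 v : e z v -> e v x -> e v y -> ham (add_edge h x y) -> ham h.
Proof.
move=> zv vx vy H; have T2 : 2 < #|T| := ham_card H.
apply: (ham_add_edge_K4 h_sym h_irr T2 (sub_eh zv)) H; rewrite ?sub_eh //.
move=> w /orP[/center_nbr zw|vw]; first by apply: nbr_z_near; rewrite zw orbT.
have [evw|nvw] := boolP (e v w); last by apply: nbr_z_near; have [] := new_edge_in_nbhd vw nvw.
apply: near_sub; rewrite /near.
have [//|wx] := eqVneq w x; have [//|wy] := eqVneq w y.
have := cf vx vy evw xy; rewrite [x == w]eq_sym [y == w]eq_sym (negbTE nexy).
exact.
Qed.

Lemma ham_add_distance3 :
  (forall a b v, a != b -> e z a -> e z b -> e z v -> e v a -> e v b -> h a b) ->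
  ham (add_edge h x y) -> ham h.
Proof.
move=> close2 H; have T2 : 2 < #|T| := ham_card H.
have far v : e z v -> ~~ (e v x && e v y).
  by move=> zv; apply: contra nhxy => /andP[vx vy]; apply: close2 vx vy.
have side v : e z v -> [|| v == x, v == y, e v x | e v y].
  by move=> zv; rewrite ![e v _]e_sym; apply: center_near.
have clique a b t t' : e z a -> e z b -> e z t' -> a != b -> t != t' -> ~~ e t t' ->
    (forall v, e z v -> ~~ (e v t && e v t')) ->
    (a == t) || e a t -> (b == t) || e b t -> e a b.
  move=> za zb zt' ab tt' ntt' fartt' /predU1P[aE|at_] /predU1P[bE|bt].
  - by rewrite aE bE eqxx in ab.
  - by rewrite aE e_sym.
  - by rewrite bE.
  have anb v : e z v -> e v t -> v != t' /\ ~~ e v t'.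
    move=> zv vt; split; last by move: (fartt' v zv); rewrite vt.
    by apply: contraNneq ntt' => <-; rewrite e_sym.
  have [at' /negbTE nat'] := anb a za at_; have [bt' /negbTE nbt'] := anb b zb bt.
  have := cf za zb zt' ab at' bt'.
  by rewrite nat' nbt' !orbF.
have farC v : e z v -> ~~ (e v y && e v x) by rewrite andbC; apply: far.
have nside t t' : (t == x) && (t' == y) || (t == y) && (t' == x) ->
   ~~ [&& (x0 == t) || e x0 t & (y0 == t) || e y0 t].
  move=> tt'; apply: contra nexy0 => /andP[x0t y0t].
  have [[tE t'E]|[tE t'E]] : (t = x /\ t' = y) \/ (t = y /\ t' = x).
    by case/orP: tt' => /andP[/eqP-> /eqP->]; auto.
  - by rewrite tE in x0t y0t; apply: (@clique x0 y0 x y).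
  - rewrite tE in x0t y0t; apply: (@clique x0 y0 y x) => //; first by rewrite eq_sym.
    by rewrite e_sym.
(* [N(z)] splits into the cliques of vertices near [x] and near [y], and the
   path [x0 u0 y0] crosses from one to the other. *)
have sideP v : e z v -> ((v == x) || e v x) \/ ((v == y) || e v y).
  by move/side=> /or4P[]->; rewrite ?orbT; auto.
have [p [q [zp zq px pq qy]]] :
    exists p q, [/\ e z p, e z q, (p == x) || e p x, e p q & (q == y) || e q y].
  have := nside x y; rewrite !eqxx => /(_ isT) nx.
  have := nside y x; rewrite !eqxx orbT => /(_ isT) ny.
  have [x0x|x0y] := sideP _ zx0; have [y0x|y0y] := sideP _ zy0.
  - by move: nx; rewrite x0x y0x.
  - have [ux|uy] := sideP _ zu0; first by exists u0, y0.
    by exists x0, u0; split; rewrite // e_sym.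
  - have [ux|uy] := sideP _ zu0; first by exists u0, x0.
    by exists y0, u0; split; rewrite // e_sym.
  - by move: ny; rewrite x0y y0y.
(* If [p] were [x], then [q] would be adjacent to [x] and belong to the closed neighbourhood of [y],
   which [far] and the non-edge [x y] forbid. *)
have epx : e p x.
  case/predU1P: px pq => // -> xq; case/predU1P: qy xq => [->|qy xq].
    by rewrite (negbTE nexy).
  by have := far q zq; rewrite qy e_sym xq.
have eqy : e q y.
  case/predU1P: qy pq => // -> py; case/predU1P: px py => [->|px' py].
    by rewrite (negbTE nexy).
  by have := far p zp; rewrite py epx.
have npy : ~~ e p y by have := far p zp; rewrite epx.
have nqx : ~~ e q x by have := far q zq; rewrite eqy andbT.
have py : p != y by apply: contraNneq nexy => <-; rewrite e_sym.
have qx : q != x by apply: contraNneq nexy => <-.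
have hpy : h p y by apply: (close2 p y q) => //; rewrite e_sym.
have hqx : h q x by apply: (close2 q x p).
(* Vertices of the closed neighbourhood of [z] are near, so a far vertex is joined to [N(z)] by
   edges of [e] only, and claws of [e] apply to it. *)
have far_new a w : e z a -> h a w -> ~~ near h x y w ->
    [/\ e a w, w != x, w != y, ~~ e x w & ~~ e y w] /\ ~~ ((w == z) || e z w).
  move=> za aw nw; have wz : ~~ ((w == z) || e z w) by apply: contra nw; apply: nbr_z_near.
  split=> //; have eaw : e a w by apply: contraNT wz => /(new_edge_in_nbhd aw)[].
  have : ~~ near e x y w by apply: contra nw; apply: near_sub.
  by rewrite /near !negb_or => /and4P[].
have far_nbr b w : e z b -> ~~ ((w == z) || e z w) -> b != w.
  by move=> zb; apply: contraNneq => <-; rewrite zb orbT.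
apply: (ham_add_edge_K5 h_sym h_irr T2 (z := z) (p := p) (q := q)) H.
split.
- by do ![split] => //; apply: sub_eh.
- by move=> w /center_nbr zw; apply: nbr_z_near; rewrite zw orbT.
- move=> w pw nw; have [[epw wx wy xw yw] wz] := far_new p w zp pw nw.
  have := cf epx pq epw; rewrite ![x == _]eq_sym qx wx far_nbr //.
  move=> /(_ isT isT isT); rewrite e_sym (negbTE nqx) (negbTE xw); exact: sub_eh.
- move=> w qw nw; have [[eqw wx wy xw yw] wz] := far_new q w zq qw nw.
  have qp : e q p by rewrite e_sym.
  have := cf eqy qp eqw.
  rewrite ![y == _]eq_sym py wy far_nbr //.
  move=> /(_ isT isT isT); rewrite e_sym (negbTE npy) (negbTE yw); exact: sub_eh.
move=> w w' ww' pw pw' nw nw'.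
have [[epw wx wy xw yw] wz] := far_new p w zp pw nw.
have [[epw' wx' wy' xw' yw'] wz'] := far_new p w' zp pw' nw'.
have := cf epx epw epw'; rewrite ![x == _]eq_sym wx wx' (negbTE xw) (negbTE xw') /=.
by move/(_ isT isT ww'); apply: sub_eh.
Qed.
End Missing.
End Intermediate.

(** Induction on the number of missing pairs. Pairs with a common neighbour in [N(z)] are added
    first, because the treatment of the others assumes that none of these is missing. *)
Lemma ham_completion : ham (completion e z) -> ham e.
Proof.
pose missing (h : rel T) := [pred ab : T * T | completion e z ab.1 ab.2 && ~~ h ab.1 ab.2].
suff: forall n (h : rel T), #|missing h| <= n -> symmetric h -> irreflexive h -> subrel e h ->
    subrel h (completion e z) -> ham (completion e z) -> ham h.
  by move/(_ _ e (leqnn _)); apply=> // a b ab; rewrite /completion ab.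
elim=> [|n IHn] h.
  rewrite leqn0 => /eqP/card0_eq h0 _ _ _ sub_hc; apply: ham_eq => a b.
  apply/idP/idP; last exact: sub_hc.
  by move=> cab; have := h0 (a, b); rewrite !inE /= cab /= => /negbFE.
move=> card_h h_sym h_irr sub_eh sub_hc H.
have step x y : completion e z x y -> ~~ h x y -> ham (add_edge h x y).
  move=> cxy nhxy; have xy : x != y by apply: contraTneq cxy => ->; rewrite completion_irr.
  apply: (IHn) H.
  - rewrite -ltnS; apply: leq_trans card_h; apply: proper_card; apply/properP; split.
      by apply/fintype.subsetP => -[a b]; rewrite !inE /add_edge /= => /andP[-> /norP[]].
    by exists (x, y); rewrite !inE /= ?cxy ?nhxy // /add_edge !eqxx orbT.
  - exact: add_edge_sym.
  - exact: add_edge_irr.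
  - by move=> a b ab; rewrite /add_edge sub_eh.
  - move=> a b /or3P[/sub_hc //|/andP[/eqP-> /eqP->] //|/andP[/eqP-> /eqP->]].
    by rewrite completion_sym.
have nbr x y : completion e z x y -> ~~ h x y -> [/\ x != y, e z x & e z y].
  move=> cxy nhxy; have xy : x != y by apply: contraTneq cxy => ->; rewrite completion_irr.
  have nexy : ~~ e x y by apply: contra nhxy; apply: sub_eh.
  move: cxy; rewrite /completion (negbTE nexy) xy /= => /andP[].
  case: eqP => [xz _|_ /= zx].
    by rewrite -xz (negbTE nexy) orbF eq_sym (negbTE xy).
  by case: eqP => [yz|_ /= -> //]; rewrite yz e_sym zx in nexy.
have [/existsP[x /existsP[y /existsP[v /and5P[cxy nhxy zv vx vy]]]]|none] :=
    boolP [exists x, exists y, exists v,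
      [&& completion e z x y, ~~ h x y, e z v, e v x & e v y]].
  have [xy zx zy] := nbr _ _ cxy nhxy.
  by apply: (ham_add_distance2 h_sym h_irr sub_eh sub_hc xy nhxy zx zy zv) => //; apply: step.
have [/existsP[x /existsP[y /andP[cxy nhxy]]]|none'] :=
    boolP [exists x, exists y, completion e z x y && ~~ h x y]; last first.
  apply: ham_eq H => a b; apply/idP/idP; last exact: sub_hc.
  move=> cab; apply: contraNT none' => nhab.
  by apply/existsP; exists a; apply/existsP; exists b; rewrite cab.
have [xy zx zy] := nbr _ _ cxy nhxy.
apply: (ham_add_distance3 h_sym h_irr sub_eh sub_hc xy nhxy zx zy _ (step _ _ cxy nhxy)).
move=> a b v ab za zb zv va vb; apply: contraNT none => nhab.
apply/existsP; exists a; apply/existsP; exists b; apply/existsP; exists v.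
by rewrite nhab zv va vb /completion ab za zb !orbT.
Qed.
End NonhamCompletion.

Definition diamond_free e := forall z u x y,
  e z u -> e z x -> e z y -> e u x -> e u y -> x != y -> e x y.

(* Ryjacek's closure: keep completing neighbourhoods that contain the two
   nonadjacent vertices of a diamond. *)
Lemma exists_closure e : symmetric e -> irreflexive e -> clawfree e -> ~ ham e ->
  exists h, [/\ symmetric h, irreflexive h & clawfree h] /\
    [/\ subrel e h, ~ ham h & diamond_free h].
Proof.
have [n] := ubnP #|[pred ab : T * T | ~~ e ab.1 ab.2]|.
elim: n e => // n IHn e; rewrite ltnS => card_e e_sym e_irr cf nh.
have [df|] := boolP [forall z, forall u, forall x, forall y,
    [&& e z u, e z x, e z y, e u x, e u y & x != y] ==> e x y].
  exists e; do ![split] => // z u x y zu zx zy ux uy xy.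
  move/forallP/(_ z)/forallP/(_ u)/forallP/(_ x)/forallP/(_ y): df.
  by rewrite zu zx zy ux uy xy.
case/forallPn=> z /forallPn[u /forallPn[x /forallPn[y]]].
rewrite negb_imply => /andP[/and5P[zu zx zy ux /andP[uy xy]] nxy].
have [|||||h [h1 [sub_h nhh dfh]]] := IHn (completion e z).
- apply: leq_trans card_e; apply: proper_card; apply/properP; split.
    by apply/fintype.subsetP => -[a b]; rewrite !inE /completion /= => /norP[].
  by exists (x, y); rewrite !inE //= /completion xy zx zy !orbT.
- exact: completion_sym.
- exact: completion_irr.
- exact: clawfree_completion.
- by move=> H; apply: nh; apply: (ham_completion _ _ _ zu zx zy ux uy xy nxy) H.
exists h; split=> //; split=> // a b ab; apply: sub_h.
by rewrite /completion ab.
Qed.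
End Completion.

(** * Path systems attached to a large clique *)

Ltac counts :=
  do 8 rewrite -?cats1
    ?(flatten_cat, count_cat, count_rev, size_cat, size_rev, cats0, addn0) /=;
  clear; lia.

Ltac edges :=
  rewrite /walk /=; repeat (apply/andP; split);
  first [done | by rewrite eqxx | match goal with H : symmetric _ |- _ => by rewrite H end].

Section Segments.
Variables (T : finType) (e : rel T) (K : {set T}).
Hypotheses (e_sym : symmetric e) (e_irr : irreflexive e) (cf : clawfree e).
Hypothesis T2 : 2 < #|T|.
Hypothesis K_clique : forall a b, a \in K -> b \in K -> a != b -> e a b.

Definition inK (x : T) : bool := x \in K.

(* The two endpoints account for [count inK s = 2], so a segment is a path
   between two vertices of [K] whose nonempty interior avoids [K]. *)
Definition segment (s : seq T) :=
  exists a b, [/\ walk e s a b, inK a, inK b, count inK s = 2 & 2 < size s].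

Definition system (S : seq (seq T)) :=
  (forall s, s \in S -> segment s) /\ uniq (flatten S).

Definition coverage (S : seq (seq T)) := count (predC inK) (flatten S).

Lemma walk_mem1 s x y : walk e s x y -> x \in s.
Proof. by case/walk_headE=> s' ->; rewrite mem_head. Qed.

Lemma walk_mem2 s x y : walk e s x y -> y \in s.
Proof. by case/walk_lastE=> s' ->; rewrite mem_rcons mem_head. Qed.

Lemma walk_flatten W :
  (forall s, s \in W -> exists a b, [/\ walk e s a b, inK a & inK b]) ->
  uniq (flatten W) -> W != [::] ->
  exists a b, [/\ walk e (flatten W) a b, inK a & inK b].
Proof.
elim: W => //= s [|s' W] IHW segW UW _.
  by rewrite cats0; apply: segW; rewrite mem_head.
have [|||a' [b [wW aK' bK]]] := IHW.
- by move=> t tW; apply: segW; rewrite inE tW orbT.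
- by move: UW; rewrite cat_uniq => /and3P[].
- by [].
have [a [b' [ws aK bK']]] := segW s (mem_head _ _).
exists a, b; split=> //; apply: (walk_cat ws _ wW); apply: K_clique => //.
move: UW; rewrite cat_uniq => /and3P[_ /hasPn dis _].
have := dis a' (walk_mem1 wW); apply: contraNneq => <-; exact: walk_mem2 ws.
Qed.

Lemma ham_system S : system S -> (forall x, ~~ inK x -> x \in flatten S) -> ham e.
Proof.
case=> segS US cov.
pose rest := [seq x <- enum T | x \notin flatten S].
pose W := S ++ [seq [:: k] | k <- rest].
have EW : flatten W = flatten S ++ rest.
  rewrite flatten_cat; congr (_ ++ _).
  by elim: (rest) => //= k r ->.
have sp : spanning (flatten W).
  rewrite EW; apply: uniq_perm; rewrite ?enum_uniq //.
    rewrite cat_uniq US filter_uniq ?enum_uniq // andbT.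
    by apply/hasPn => x; rewrite mem_filter => /andP[].
  by move=> x; rewrite mem_cat mem_filter mem_enum andbT orbN.
have [||a [b [wW aK bK]]] := @walk_flatten W _ (spanning_uniq sp).
- move=> s; rewrite mem_cat => /orP[/segS [a [b [? ? ? _ _]]]|/mapP[k + ->]].
    by exists a, b.
  rewrite mem_filter => /andP[kS _]; exists k, k; rewrite walk1; split=> //;
  by apply: contraNT kS => /cov.
- apply: contraTneq T2 => W0; have := perm_size sp.
  by rewrite W0 /= -cardE => <-.
apply: (ham_walk _ wW) => //; apply: K_clique => //.
apply: contraTneq T2 => ba; rewrite cardE -(perm_size sp).
have [s Es] := walk_headE wW; have Us := spanning_uniq sp.
rewrite {}Es in Us wW *; case/lastP: s Us wW => // s c Us wW.
by have cb := walk_last (A := a :: s) wW; rewrite /= mem_rcons -ba -cb mem_head in Us.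
Qed.

Lemma segment_rev s : segment s -> segment (rev s).
Proof.
case=> a [b [ws aK bK cs ss]]; exists b, a.
by split; rewrite ?count_rev ?size_rev //; apply: walk_rev.
Qed.

Hypothesis K_one : forall r a b, ~~ inK r -> inK a -> inK b -> e r a -> e r b -> a = b.
Hypothesis K_att : forall a r r', inK a -> ~~ inK r -> ~~ inK r' ->
  e a r -> e a r' -> r != r' -> e r r'.

(** * Exchange arguments on maximal path systems *)

Definition maximal S := system S /\ forall S', system S' -> coverage S' <= coverage S.

Lemma system_perm S S' : perm_eq S S' -> system S -> system S'.
Proof.
move=> pS [segS US]; split=> [s|]; first by rewrite -(perm_mem pS); apply: segS.
by rewrite -(perm_uniq (perm_flatten pS)).
Qed.

Lemma coverage_perm S S' : perm_eq S S' -> coverage S = coverage S'.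
Proof. by move=> pS; apply/permP/perm_flatten. Qed.

Lemma maximal_perm S S' : perm_eq S S' -> maximal S -> maximal S'.
Proof.
by move=> pS [sS mS]; split; rewrite -?(coverage_perm pS) //; apply: system_perm sS.
Qed.

Lemma uniq_count (s : seq T) : (forall x, count_mem x s <= 1) -> uniq s.
Proof.
move=> cs; apply: count_mem_uniq => x; have := cs x.
by rewrite -has_pred1 has_count; case: (count_mem x s) => [|[|]].
Qed.

Lemma uniq_sub (s s' : seq T) : uniq s' ->
  (forall P : pred T, count P s <= count P s') -> uniq s.
Proof.
by move=> Us' sub; apply: uniq_count => x; rewrite (leq_trans (sub _)) // count_uniq_mem ?leq_b1.
Qed.

Lemma count_uniq (s : seq T) x : uniq s -> count_mem x s <= 1.
Proof. by move=> Us; rewrite count_uniq_mem // leq_b1. Qed.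

(** The exchange principle behind every contradiction with maximality: [olds] is replaced by [news],
    built from its vertices and uncovered ones. The last premise says that [news] has more vertices
    outside [K], with the subtractions moved across. *)
Lemma improve (olds S0 news : seq (seq T)) (fresh : seq T) :
  maximal (olds ++ S0) ->
  (forall s, s \in news -> segment s) -> uniq fresh ->
  (forall x, x \in fresh -> x \notin flatten (olds ++ S0)) ->
  (forall P : pred T, count P (flatten news) <= count P (flatten olds ++ fresh)) ->
  size (flatten olds) + count inK (flatten news)
    < size (flatten news) + count inK (flatten olds) -> False.
Proof.
case=> [[segS US] maxS] segN Uf dis cnt lt.
have sys : system (news ++ S0).
  split=> [s|].
    by rewrite mem_cat => /orP[/segN //|sS]; apply: segS; rewrite mem_cat sS orbT.
  apply: uniq_count => x; have := cnt (pred1 x).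
  have := count_uniq x US; have := count_uniq x Uf.
  rewrite !flatten_cat !count_cat.
  have : (count_mem x fresh == 0) ||
      (count_mem x (flatten olds) + count_mem x (flatten S0) == 0).
    have [xf|xf] := boolP (x \in fresh); last by rewrite (count_memPn xf).
    have := dis x xf; rewrite flatten_cat mem_cat negb_or => /andP[xo xS].
    by rewrite (count_memPn xo) (count_memPn xS) orbT.
  move: (count_mem x (flatten olds)) (count_mem x (flatten news)) (count_mem x fresh).
  move: (count_mem x (flatten S0)) => i j k l; clear; lia.
have := maxS _ sys; rewrite /coverage !flatten_cat !count_cat.
have := count_predC inK (flatten olds); have := count_predC inK (flatten news).
move: lt; clear; lia.
Qed.


Definition free_walk (S : seq (seq T)) (D : seq T) (d1 d2 : T) :=
  [/\ walk e D d1 d2, uniq D, (forall x, x \in D -> x \notin flatten S) &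
      (forall x, x \in D -> ~~ inK x)].

Lemma free_walk_rev S D d1 d2 : free_walk S D d1 d2 -> free_walk S (rev D) d2 d1.
Proof.
case=> wD UD fD KD; split; rewrite ?rev_uniq //; first exact: walk_rev.
- by move=> x; rewrite mem_rev; apply: fD.
- by move=> x; rewrite mem_rev; apply: KD.
Qed.

Lemma free_walk_count S D d1 d2 : free_walk S D d1 d2 ->
  count inK D = 0 /\ 0 < size D.
Proof.
case=> wD _ _ KD; split; last by case: (D) wD.
by apply/eqP; rewrite -leqn0 leqNgt -has_count; apply/hasPn.
Qed.

Lemma maximal_system S : maximal S -> system S.
Proof. by case. Qed.

Lemma maximal_seg s S0 : maximal (s :: S0) -> segment s.
Proof. by case=> [[segS _] _]; apply: segS; rewrite mem_head. Qed.

Lemma maximal_uniq s S0 : maximal (s :: S0) -> uniq s.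
Proof. by case=> [[_ US] _]; move: US; rewrite /= cat_uniq => /and3P[]. Qed.

Lemma maximal_rev s S0 : maximal (s :: S0) -> maximal (rev s :: S0).
Proof.
case=> [[segS US] maxS]; split; last first.
  move=> S' /maxS; rewrite /coverage /= !count_cat count_rev; exact.
split=> [t|].
  rewrite inE => /predU1P[->|tS]; last by apply: segS; rewrite inE tS orbT.
  by apply: segment_rev; apply: segS; rewrite mem_head.
by rewrite -(perm_uniq (s1 := flatten (s :: S0))) //= perm_cat2r perm_sym perm_rev.
Qed.

Lemma mem_flatten1 (s : seq T) S0 x : x \notin flatten (s :: S0) -> x \notin s.
Proof. by rewrite /= mem_cat negb_or => /andP[]. Qed.

Lemma mem_flatten_rev (s : seq T) S0 : flatten (rev s :: S0) =i flatten (s :: S0).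
Proof. by move=> x; rewrite /= !mem_cat mem_rev. Qed.

Lemma insert_contra A x u B S0 d :
  maximal ((A ++ x :: u :: B) :: S0) -> d \notin flatten ((A ++ x :: u :: B) :: S0) ->
  ~~ inK d -> e d x -> e d u -> False.
Proof.
move=> mS fd dK dx du; have [a [b [ws aK bK cK sz]]] := maximal_seg mS.
have [wA /walk_uncons[xu wB]] := walk_cut ws.
apply: (@improve [:: A ++ x :: u :: B] S0 [:: A ++ x :: d :: u :: B] [:: d]) => //.
- move=> s; rewrite inE => /eqP->; exists a, b; split=> //.
  + rewrite -cat_rcons; apply: (walk_cat wA (v := d)); first by rewrite e_sym.
    exact: walk_cons wB.
  + by move: cK dK; rewrite !count_cat /=; case: (inK d).
  + by move: sz; rewrite !size_cat /=; clear; lia.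
- by move=> y; rewrite inE => /eqP->.
- by move=> P; counts.
- move: dK; case E: (inK d) => // _.
  by rewrite /= !cats0 !count_cat !size_cat /= E; clear; lia.
Qed.

(** Among the neighbours [x], [y], [d] of [u], neither [x] nor [y] sees [d], since [d] could
    otherwise be inserted next to [u]. Claw-freeness leaves the edge [x y], a shortcut past [u]. *)
Lemma claw_at L x u y N S0 d :
  maximal ((L ++ x :: u :: y :: N) :: S0) ->
  d \notin flatten ((L ++ x :: u :: y :: N) :: S0) -> ~~ inK d -> e u d -> e x y.
Proof.
move=> mS fd dK ud; have [a [b [ws aK bK cK sz]]] := maximal_seg mS.
have [_ /walk_uncons[xu /walk_uncons[uy _]]] := walk_cut ws.
have ux : e u x by rewrite e_sym.
have Us := maximal_uniq mS; have ds := mem_flatten1 fd.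
have xy : x != y.
  by move: Us; rewrite cat_uniq /= !inE !negb_or => /and3P[_ _ /andP[/and3P[_ ? _]]].
have [xd yd] : x != d /\ y != d.
  by split; apply: contraNneq ds => <-; rewrite mem_cat !inE eqxx ?orbT.
have := cf ux uy ud xy xd yd => /or3P[//|dx|dy]; exfalso.
  apply: (insert_contra mS fd dK) => //; by rewrite e_sym.
apply: (@insert_contra (rcons L x) u y N S0 d) => //; rewrite ?cat_rcons // e_sym //.
Qed.

Lemma perm_eq_head (S : seq (seq T)) s : s \in S -> exists S0, perm_eq S (s :: S0).
Proof. by move=> sS; exists (rem s S); apply: perm_to_rem. Qed.

(** On a segment [c] would have to be an end. The next vertex [p] and [d] are then outside
    neighbours of the same clique vertex, hence adjacent, and [d] fits between [c] and [p]. *)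
Lemma fresh_att S c d : maximal S -> inK c -> d \notin flatten S -> ~~ inK d ->
  e d c -> c \notin flatten S.
Proof.
move=> mS cK fd dK dc; apply/negP => /flattenP[s sS cs].
have [S0 pS] := perm_eq_head sS.
have {mS} mS := maximal_perm pS mS.
have {fd} fd : d \notin flatten (s :: S0) by rewrite -(perm_mem (perm_flatten pS)).
wlog [B sE] : s {sS pS cs} mS fd / exists B, s = c :: B.
  move=> th; case/splitPr: cs mS fd {sS pS} => A B mS fd.
  have [a [b [ws aK bK cK' sz]]] := maximal_seg mS.
  case: A mS fd ws cK' sz => [|a' A] mS fd ws cK' sz.
    by apply: (th (c :: B)) => //; exists B.
  have aE := walk_head (A := A ++ c :: B) ws.
  case/lastP: B mS fd ws cK' sz => [|B b'] mS fd ws cK' sz.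
    apply: (th (rev ((a' :: A) ++ [:: c]))); first exact: maximal_rev.
      by rewrite mem_flatten_rev.
    by exists (rev (a' :: A)); rewrite cats1 rev_rcons.
  have bE : b' = b by move: ws; rewrite -rcons_cons -rcons_cat => /walk_last.
  move: cK'; rewrite /= count_cat /= -cats1 count_cat /= aE bE aK bK cK; clear; lia.
rewrite {}sE in mS fd; have [a [b [ws aK bK cK' sz]]] := maximal_seg mS.
case: B mS fd ws cK' sz => [//|p [//|q B]] mS fd ws cK' sz.
have [cp /walk_uncons[pq wq]] := walk_uncons ws.
have pK : ~~ inK p.
  have [B' EB] := walk_lastE wq.
  by move: cK'; rewrite EB /= -cats1 count_cat /= cK bK; case: (inK p) => //; clear; lia.
apply: (@insert_contra [::] c p (q :: B) S0 d) => //.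
apply: (K_att cK) => //; first by rewrite e_sym.
by apply: contraNneq (mem_flatten1 fd) => ->; rewrite !inE eqxx orbT.
Qed.

Lemma two_K_contra S D d1 d2 c1 c2 : maximal S -> free_walk S D d1 d2 ->
  inK c1 -> inK c2 -> c1 != c2 -> e d1 c1 -> e d2 c2 -> False.
Proof.
move=> mS fw c1K c2K c12 dc1 dc2; have [cD sD] := free_walk_count fw.
have [wD UD fD KD] := fw; have d1D := walk_mem1 wD; have d2D := walk_mem2 wD.
have f1 := fresh_att mS c1K (fD _ d1D) (KD _ d1D) dc1.
have f2 := fresh_att mS c2K (fD _ d2D) (KD _ d2D) dc2.
apply: (@improve [::] S [:: c1 :: D ++ [:: c2]] (c1 :: c2 :: D)) => //.
- move=> s; rewrite inE => /eqP->; exists c1, c2; split=> //.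
  + apply: (walk_cons (v := d1)) => //; first by rewrite e_sym.
    exact: walk_cat wD dc2 (walk1 e c2).
  + by rewrite /= count_cat /= cD c1K c2K.
  + by rewrite /= size_cat /=; move: sD; clear; lia.
- rewrite /= inE negb_or c12 UD andbT /=; apply/andP; split; apply/negP => cD'.
    by have := KD _ cD'; rewrite c1K.
  by have := KD _ cD'; rewrite c2K.
- by move=> x; rewrite !inE => /or3P[/eqP->|/eqP->|/fD].
- by move=> P; counts.
- rewrite /= cats0 count_cat size_cat /= cD c1K c2K; move: sD; clear; lia.
Qed.


(** If [L] had at most one vertex, the segment could start with [c], [D] backwards, [u] instead,
    keeping an interior [x] by the shortcut [x y]. Only the old end in [K] is given up. *)
Lemma attached_left L x u y N S0 D d1 d2 c :
  maximal ((L ++ x :: u :: y :: N) :: S0) ->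
  free_walk ((L ++ x :: u :: y :: N) :: S0) D d1 d2 ->
  e u d1 -> e d2 c -> inK c -> ~~ inK u -> 1 < size L.
Proof.
move=> mS fw ud dc cK uK; have [cD sD] := free_walk_count fw.
have [wD UD fD KD] := fw; have d1D := walk_mem1 wD; have d2D := walk_mem2 wD.
have fc := fresh_att mS cK (fD _ d2D) (KD _ d2D) dc.
have xy : e x y := claw_at mS (fD _ d1D) (KD _ d1D) ud.
have [a [b [ws aK bK cK' sz]]] := maximal_seg mS.
have [wL /walk_uncons[xu /walk_uncons[uy wN]]] := walk_cut ws.
have ud' : e d1 u by rewrite e_sym.
have cd2 : e c d2 by rewrite e_sym.
have cu := walk_rev e_sym wD.
have Uc : uniq (c :: D).
  by rewrite /= UD andbT; apply/negP => /KD; rewrite cK.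
have fcD z : z \in c :: D -> z \notin flatten ((L ++ x :: u :: y :: N) :: S0).
  by rewrite inE => /predU1P[->|/fD].
have uK0 : inK u = false := negbTE uK.
rewrite ltnNge; apply/negP.
case: L mS fw fD fc ws cK' sz wL fcD => [|a' [|? ?]] //= mS fw fD fc ws cK' sz wL fcD _.
- have xK : inK x by rewrite (walk_head ws).
  apply: (@improve [:: x :: u :: y :: N] S0 [:: c :: rev D ++ u :: y :: N] (c :: D)) => //.
  + move=> s; rewrite inE => /eqP->; exists c, b; split=> //.
    * apply: (walk_cons (v := d2)) => //; apply: (walk_cat cu ud').
      exact: (walk_cons (v := y)).
    * move: cK'; rewrite /= count_cat count_rev /= cD cK xK uK0; clear; lia.
    * by move: sD; rewrite /= size_cat size_rev /=; clear; lia.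
  + by move=> P; counts.
  + move: sD cK'; rewrite /= !cats0 count_cat count_rev size_cat size_rev /= cD cK xK uK0.
    by clear; lia.
- have a'K : inK a' by rewrite (walk_head ws).
  apply: (@improve [:: a' :: x :: u :: y :: N] S0
    [:: c :: rev D ++ u :: x :: y :: N] (c :: D)) => //.
  + move=> s; rewrite inE => /eqP->; exists c, b; split=> //.
    * apply: (walk_cons (v := d2)) => //; apply: (walk_cat cu ud').
      apply: (walk_cons (v := x)) => //; first by rewrite e_sym.
      exact: (walk_cons (v := y)).
    * move: cK'; rewrite /= count_cat count_rev /= cD cK a'K uK0; clear; lia.
    * by move: sD; rewrite /= size_cat size_rev /=; clear; lia.
  + by move=> P; counts.
  + move: sD cK'; rewrite /= !cats0 count_cat count_rev size_cat size_rev /= cD cK a'K uK0.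
    by clear; lia.
Qed.

Lemma attached_right L x u y N S0 D d1 d2 c :
  maximal ((L ++ x :: u :: y :: N) :: S0) ->
  free_walk ((L ++ x :: u :: y :: N) :: S0) D d1 d2 ->
  e u d1 -> e d2 c -> inK c -> ~~ inK u -> 1 < size N.
Proof.
move=> /maximal_rev mS fw.
have E : rev (L ++ x :: u :: y :: N) = rev N ++ y :: u :: x :: rev L.
  by rewrite rev_cat !rev_cons !cat_rcons.
rewrite -[size N]size_rev.
apply: (@attached_left (rev N) y u x (rev L) S0 D d1 d2 c); rewrite -?E //.
case: fw => wD UD fD KD; split=> // z zD.
by rewrite mem_flatten_rev; apply: fD.
Qed.

(** With at most two vertices between [u] and [u'], the walk [D] can replace the stretch between
    them: the vertices of [M] are moved to the other side of [u] or [u'], along the shortcuts of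
    [claw_at]. *)
Lemma same_segment_gap L x u M u' y' N S0 D d1 d2 :
  maximal ((L ++ x :: u :: M ++ u' :: y' :: N) :: S0) ->
  free_walk ((L ++ x :: u :: M ++ u' :: y' :: N) :: S0) D d1 d2 ->
  e u d1 -> e u' d2 -> 2 < size M.
Proof.
move=> mS fw ud ud'; have [cD sD] := free_walk_count fw.
have [wD UD fD KD] := fw; have d1D := walk_mem1 wD; have d2D := walk_mem2 wD.
have [a [b [ws aK bK cK' sz]]] := maximal_seg mS.
have du' : e d2 u' by rewrite e_sym.
rewrite ltnNge; apply/negP => M2.
have replaced s : walk e s a b ->
    (forall P : pred T,
      count P s = count P ((L ++ x :: u :: M ++ u' :: y' :: N) ++ D)) -> False.
  move=> ws' cs; have size_s : size s = size ((L ++ x :: u :: M ++ u' :: y' :: N) ++ D).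
    by have := cs predT; rewrite !count_predT.
  have cKs : count inK s = 2 by rewrite cs count_cat cK' cD.
  apply: (@improve [:: L ++ x :: u :: M ++ u' :: y' :: N] S0 [:: s] D) => //.
  - move=> t; rewrite inE => /eqP->; exists a, b; split=> //.
    by rewrite size_s size_cat; move: sz; clear; lia.
  - by move=> P; rewrite /= !cats0 cs.
  - rewrite /= !cats0 cKs cK' size_s [size (_ ++ D)]size_cat; move: sD; clear; lia.
have [wL] := walk_cut ws; rewrite -cat_cons => /walk_uncons[xu].
case: M M2 mS fw fD ws cK' sz replaced => [|m [|m2 [|? ?]]] //= _ mS fw fD ws cK' sz replaced.
- case/walk_uncons=> uu' wN.
  apply: (replaced (rcons L x ++ u :: D ++ u' :: y' :: N)); last by move=> P; counts.
  apply: (walk_cat wL xu); apply: (walk_cons (v := d1)) => //.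
  exact: (walk_cat wD du').
- case/walk_uncons=> um /walk_uncons[mu' wN].
  have xm : e x m by apply: (claw_at mS (fD _ d1D) (KD _ d1D) ud).
  apply: (replaced (rcons L x ++ m :: u :: D ++ u' :: y' :: N)); last by move=> P; counts.
  apply: (walk_cat wL xm); apply: (walk_cons (v := u)) => //; first by rewrite e_sym.
  apply: (walk_cons (v := d1)) => //; exact: (walk_cat wD du').
- case/walk_uncons=> um /walk_uncons[mm2 /walk_uncons[mu' /walk_uncons[uy' wN]]].
  have xm : e x m by apply: (claw_at mS (fD _ d1D) (KD _ d1D) ud).
  have E : L ++ x :: u :: m :: m2 :: u' :: y' :: N
      = (L ++ [:: x; u; m]) ++ m2 :: u' :: y' :: N.
    by rewrite -catA.
  have my : e m2 y'.
    by apply: (@claw_at (L ++ [:: x; u; m]) m2 u' y' N S0 d2); rewrite -?E ?fD ?KD.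
  apply: (replaced (rcons L x ++ m :: u :: D ++ u' :: m2 :: y' :: N)); last by move=> P; counts.
  apply: (walk_cat wL xm); apply: (walk_cons (v := u)) => //; first by rewrite e_sym.
  apply: (walk_cons (v := d1)) => //; apply: (walk_cat wD du').
  apply: (walk_cons (v := m2)) => //; first by rewrite e_sym.
  exact: (walk_cons (v := y')).
Qed.

(** A single interior vertex would see two distinct vertices of [K]. *)
Lemma segment_size s : segment s -> uniq s -> 3 < size s.
Proof.
case=> a [b [ws aK bK cK sz]] Us; rewrite ltnNge; apply/negP => s3.
case: s sz s3 ws cK Us => [|a' [|r [|b' [|? ?]]]] // _ _ ws.
have aE := walk_head ws; have [ar /walk_uncons[rb wb]] := walk_uncons ws.
have [_ bE] := walk1E wb; rewrite aE -bE /= aK bK => cK.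
have rK : ~~ inK r by move: cK; case: (inK r).
have ab : a = b by apply: (K_one rK aK bK); rewrite ?bE // e_sym -aE.
by rewrite ab !inE eqxx orbT.
Qed.

(** The walk [t] misses only one end of the segment. With at most three interior vertices, [u]
    either is next to an end or is the middle one; in the latter case [t] is [a' x y u], by the
    shortcut [x y]. *)
Lemma segment_reach L x u y N : segment (L ++ x :: u :: y :: N) -> ~~ inK u ->
  e x y -> size (L ++ x :: u :: y :: N) <= 5 ->
  exists a t, [/\ walk e t a u, inK a, count inK t = 1,
    forall P : pred T, count P t <= count P (L ++ x :: u :: y :: N) &
    size (L ++ x :: u :: y :: N) = (size t).+1].
Proof.
case=> a [b [ws aK bK cK sz]] uK xy s5.
have uK0 : inK u = false := negbTE uK.
have [wL /walk_uncons[xu /walk_uncons[uy wN]]] := walk_cut ws.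
case/lastP: N s5 ws wN cK sz => [|N b'] s5 ws wN cK sz.
  have yK : inK y by have [_ <-] := walk1E wN.
  exists a, (rcons L x ++ [:: u]); split=> //.
  - exact: walk_cat wL xu (walk1 _ _).
  - by move: cK; rewrite -cats1 !count_cat /= yK uK0; clear; lia.
  - by move=> P; counts.
  - by counts.
have b'E : b' = b by move: wN; rewrite -rcons_cons => /walk_last.
have b'K : inK b' by rewrite b'E.
case: L s5 ws wL cK sz => [|a' L] s5 ws wL cK sz.
  have xK : inK x by rewrite (walk_head ws).
  exists b, (rev (u :: y :: rcons N b')); split=> //.
  - by apply: walk_rev => //; apply: (walk_cons (v := y)).
  - by move: cK; rewrite count_rev /= xK; clear; lia.
  - by move=> P; counts.
  - by rewrite /= size_rev.
have a'K : inK a' by rewrite (walk_head (A := L ++ x :: u :: y :: rcons N b') ws).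
case: L s5 ws wL cK sz => [|l L] s5 ws wL cK sz; last first.
  by move: s5; rewrite /= size_cat /= size_rcons; clear; lia.
exists a, [:: a'; x; y; u]; split=> //.
- have yu : e y u by rewrite e_sym.
  by move: wL; rewrite /walk /= xy yu !eqxx !andbT => /andP[-> ->].
- move: cK; rewrite /= -cats1 count_cat /= uK0 a'K b'K; clear; lia.
- by move=> P; counts.
- by move: s5; rewrite /= size_rcons; case: (N).
Qed.

(** The walks of [segment_reach] joined by [D] form one segment that loses two vertices of [K] and
    no interior vertex. *)
Lemma two_segments_contra L x u y N L' x' u' y' N' S0 D d1 d2
    (s := L ++ x :: u :: y :: N) (s' := L' ++ x' :: u' :: y' :: N') :
  maximal (s :: s' :: S0) -> free_walk (s :: s' :: S0) D d1 d2 ->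
  e u d1 -> e u' d2 -> ~~ inK u -> ~~ inK u' -> size s <= 5 -> size s' <= 5 -> False.
Proof.
move=> mS fw ud ud' uK uK' s5 s5'; have [cD sD] := free_walk_count fw.
have [wD UD fD KD] := fw; have d1D := walk_mem1 wD; have d2D := walk_mem2 wD.
have xy : e x y := claw_at mS (fD _ d1D) (KD _ d1D) ud.
have pS : perm_eq (s :: s' :: S0) (s' :: s :: S0).
  by apply/permP => P /=; clear; lia.
have mS' := maximal_perm pS mS.
have xy' : e x' y'.
  by apply: (claw_at mS' _ (KD _ d2D) ud'); rewrite -(perm_mem (perm_flatten pS)) fD.
have [a [t [wt aK ct Pt st]]] := segment_reach (maximal_seg mS) uK xy s5.
have [a' [t' [wt' aK' ct' Pt' st']]] := segment_reach (maximal_seg mS') uK' xy' s5'.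
have [_ [_ [_ _ _ cs _]]] := maximal_seg mS.
have [_ [_ [_ _ _ cs' _]]] := maximal_seg mS'.
apply: (@improve [:: s; s'] S0 [:: t ++ D ++ rev t'] D) => //.
- move=> r; rewrite inE => /eqP->; exists a, a'; split=> //.
  + apply: (walk_cat wt ud); apply: (walk_cat wD _ (walk_rev e_sym wt')).
    by rewrite e_sym.
  + by rewrite !count_cat count_rev ct ct' cD.
  + rewrite !size_cat size_rev; move: sD st.
    have := segment_size (maximal_seg mS) (maximal_uniq mS).
    by rewrite -/s; clear; lia.
- move=> P; have := Pt P; have := Pt' P; rewrite /s /s'; counts.
- move: sD cD ct ct' cs cs' st st'; rewrite /s /s'; counts.
Qed.


(** * The shapes that six outside vertices allow *)

Hypothesis R6 : #|~: K| <= 6.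
Hypothesis K2 : 1 < #|K|.
Hypothesis conn2 : forall (D : pred T) c, (exists d, D d) -> ~~ D c ->
  (exists2 z, z != c & ~~ D z) ->
  exists d c', [/\ D d, ~~ D c', c' != c & e d c'].

Lemma outside_size (l : seq T) : uniq l -> (forall x, x \in l -> ~~ inK x) -> size l <= 6.
Proof.
move=> Ul lK; apply: leq_trans R6; rewrite -(card_uniqP Ul); apply: subset_leq_card.
by apply/fintype.subsetP => x /lK; rewrite inE.
Qed.

Lemma outside_cover (l : seq T) : uniq l -> (forall x, x \in l -> ~~ inK x) -> size l = 6 ->
  forall x, ~~ inK x -> x \in l.
Proof.
move=> Ul lK l6 x xK; apply: contraT => xl.
have := @outside_size (x :: l); rewrite /= xl Ul l6; apply=> // y.
by rewrite inE => /predU1P[->|/lK].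
Qed.

Lemma free_walk_bound S D d1 d2 : maximal S -> free_walk S D d1 d2 ->
  count (predC inK) (flatten S) + size D <= 6.
Proof.
move=> [[_ US] _] [_ UD fD KD].
rewrite -size_filter -size_cat; apply: outside_size.
  rewrite cat_uniq filter_uniq // UD andbT; apply/hasPn => x /fD.
  by rewrite mem_filter negb_and orbC => ->.
by move=> x; rewrite mem_cat mem_filter => /orP[/andP[]|/KD].
Qed.

Lemma segment_out s : segment s -> count (predC inK) s = size s - 2.
Proof. by case=> a [b [_ _ _ cK _]]; have := count_predC inK s; rewrite cK; clear; lia. Qed.

(** Take the component of [d0] among the uncovered outside vertices: 2-connectedness gives it two
    exits with distinct targets, and a duplicate-free path inside the component joins their starting
    points. *)
Lemma exists_free_walk S d0 : maximal S -> ~~ inK d0 -> d0 \notin flatten S ->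
  exists D d1 d2 c1 c2, [/\ free_walk S D d1 d2, c1 != c2, e d1 c1 & e d2 c2] /\
    (inK c1 || (c1 \in flatten S)) /\ (inK c2 || (c2 \in flatten S)).
Proof.
move=> mS d0K fd0; pose U x := ~~ inK x && (x \notin flatten S).
pose eU : rel T := fun x y => [&& e x y, U x & U y].
have eU_sym : symmetric eU by move=> x y; rewrite /eU e_sym [U x && _]andbC.
have connU x : connect eU d0 x -> U x.
  case/connectP=> p; elim/last_ind: p x => [|p z _] x; first by move=> _ ->; rewrite /U d0K.
  by rewrite rcons_path last_rcons => /andP[_ /and3P[_ _ Uz]] ->.
have out d c : connect eU d0 d -> ~~ connect eU d0 c -> e d c -> inK c || (c \in flatten S).
  move=> dd nc dc; apply: contraNT nc; rewrite negb_or => Uc.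
  by apply: (connect_trans dd); apply: connect1; rewrite /eU dc (connU _ dd).
have Knc k : inK k -> ~~ connect eU d0 k.
  by move=> kK; apply/negP => /connU; rewrite /U kK.
have /card_gt1P[k [k' [kK kK' kk']]] := K2.
have [|||d1 [c1 [dd1 nc1 _ dc1]]] := conn2 (D := connect eU d0) (c := k).
- by exists d0; apply: connect0.
- exact: Knc.
- by exists k'; rewrite ?Knc // eq_sym.
(* Avoiding the target [c1] of the first exit forces the second target to differ from it. *)
have [|||d2 [c2 [dd2 nc2 c21 dc2]]] := conn2 (D := connect eU d0) (c := c1).
- by exists d0; apply: connect0.
- exact: nc1.
- have [kc|kc] := eqVneq k c1; last by exists k; rewrite ?Knc.
  by exists k'; rewrite ?Knc // -kc eq_sym.
have : connect eU d1 d2.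
  by apply: connect_trans dd2; rewrite (sym_connect_sym eU_sym).
case/connectP=> p0 pp0; case/shortenP: pp0 => p pp Up _ lp.
have UpP x : x \in d1 :: p -> U x.
  rewrite inE => /predU1P[->|]; first exact: connU.
  by move=> xp; case/splitPr: xp pp => p1 p2; rewrite cat_path => /andP[_ /andP[/and3P[]]].
exists (d1 :: p), d1, d2, c1, c2; split; last by split; [apply: (out d1)|apply: (out d2)].
split=> //; last by rewrite eq_sym.
split=> //.
- rewrite /walk eqxx -lp eqxx andbT.
  by apply: sub_path pp => x y /and3P[].
- by move=> x /UpP /andP[].
- by move=> x /UpP /andP[].
Qed.


(** The edges [a_i b_i] are left open, as the path system does not produce them; the third clause
    makes the listed six vertices the whole complement of [K]. *)
Definition EP_config a1 a2 a3 c1 c2 c3 b1 b2 b3 :=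
  [/\ uniq [:: a1; a2; a3; c1; c2; c3; b1; b2; b3], all inK [:: a1; a2; a3],
      forall x, (x \in [:: c1; c2; c3; b1; b2; b3]) = ~~ inK x &
      all (fun p => e p.1 p.2)
        [:: (a1, c1); (c1, b1); (a2, c2); (c2, b2); (a3, c3); (c3, b3);
            (b1, b2); (b1, b3); (b2, b3)]].

(* The second shape that survives, with two attachment vertices [a], [b] in the
   clique and the triangles [a u1 v1], [b u3 v3] joined by paths. With the edges
   [u1 u3], [v1 v3] added it has as many edges as [EP_n]. *)
Definition theta_config a b u1 u2 u3 v1 v2 v3 :=
  [/\ uniq [:: a; b; u1; u2; u3; v1; v2; v3], all inK [:: a; b],
      forall x, (x \in [:: u1; u2; u3; v1; v2; v3]) = ~~ inK x &
      all (fun p => e p.1 p.2)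
        [:: (a, u1); (a, v1); (u1, v1); (u1, u2); (u2, u3); (v1, v2); (v2, v3);
            (u3, v3); (u3, b); (v3, b)]].

Lemma segment_inner (s : seq T) u : segment s -> u \in s -> ~~ inK u ->
  exists (L : seq T) (x y : T) (N : seq T), s = L ++ x :: u :: y :: N.
Proof.
case=> a [b [ws aK bK _ _]] us uK; case/splitPr: us ws => A B ws.
case/lastP: A ws => [|L x] ws; first by rewrite (walk_head ws) aK in uK.
case: B ws => [|y N] ws; last by exists L, x, y, N; rewrite cat_rcons.
by rewrite cats1 in ws; rewrite (walk_last ws) bK in uK.
Qed.

Lemma free_walk_perm S S' D d1 d2 : perm_eq S S' ->
  free_walk S D d1 d2 -> free_walk S' D d1 d2.
Proof.
move=> pS [wD UD fD KD]; split=> // x /fD.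
by rewrite (perm_mem (perm_flatten pS)).
Qed.

Lemma memE_outside (l : seq T) : uniq l -> size l = 6 -> count inK l = 0 ->
  forall x, (x \in l) = ~~ inK x.
Proof.
move=> Ul l6 cl.
have lK x : x \in l -> ~~ inK x.
  apply: contraTN => xK; apply/negP => xl; move: cl => /eqP.
  by rewrite -leqn0 leqNgt -has_count => /hasPn/(_ x xl); rewrite xK.
by move=> x; apply/idP/idP; [apply: lK | apply: outside_cover].
Qed.

(** At least two vertices on each side of [u], [x], [y] give five interior ones, and [D] adds a
    sixth. The bound is attained, which fixes all the lengths. *)
Lemma EP_of_attached S (D : seq T) d1 d2 u c : maximal S -> free_walk S D d1 d2 ->
  u \in flatten S -> ~~ inK u -> e u d1 -> e d2 c -> inK c ->
  exists a1 a2 a3 c1 c2 c3 b1 b2 b3, EP_config a1 a2 a3 c1 c2 c3 b1 b2 b3.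
Proof.
move=> mS fw /flattenP[s sS us] uK ud dc cK.
have [S0 pS] := perm_eq_head sS.
have {mS} mS := maximal_perm pS mS; have {fw} fw := free_walk_perm pS fw.
have [L [x [y [N sE]]]] := segment_inner (maximal_seg mS) us uK.
rewrite {}sE in mS fw.
have L2 := attached_left mS fw ud dc cK uK.
have N2 := attached_right mS fw ud dc cK uK.
have [cD sD] := free_walk_count fw.
have := free_walk_bound mS fw; rewrite /= count_cat (segment_out (maximal_seg mS)).
rewrite size_cat /= => bound.
have [[L2' N2'] D1] : (size L = 2 /\ size N = 2) /\ size D = 1.
  move: L2 N2 sD bound; move: (size L) (size N) (size D) (count _ (flatten S0)).
  by clear; lia.
case: L L2' {L2} mS fw {bound} => [|a1 [|c1 [|? ?]]] // _ mS fw.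
case: N N2' {N2} mS fw => [|c2 [|a2 [|? ?]]] // _ mS fw.
case: D D1 cD {sD} fw => [|d [|? ?]] // _ cD fw; rewrite /= in mS fw.
have Us := maximal_uniq mS.
have [wD _ fD KD] := fw.
have [? ?] := walk1E wD; subst d1 d2.
have dS := fD d (mem_head _ _); have dK := KD d (mem_head _ _).
have cS := fresh_att mS cK dS dK dc.
have [a [b [ws aK bK cKs _]]] := maximal_seg mS.
have a1K : inK a1 by rewrite (walk_head ws).
have a2K : inK a2 by rewrite (@walk_last _ _ [:: a1; c1; x; u; y; c2] a2 a b ws).
have xy := @claw_at [:: a1; c1] x u y [:: c2; a2] S0 d mS dS dK ud.
have U9 : uniq [:: c, d & [:: a1; c1; x; u; y; c2; a2]].
  rewrite cons_uniq [uniq (d :: _)]cons_uniq Us (mem_flatten1 dS) inE negb_or (mem_flatten1 cS).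
  by rewrite !andbT; apply: contraNneq dK => <-.
exists a1, a2, c, c1, c2, d, x, y, u; split.
- by apply: (uniq_sub U9) => P; counts.
- by rewrite /= a1K a2K cK.
- apply: memE_outside => //.
    by apply: (uniq_sub U9) => P; counts.
  by move: cKs cD; rewrite /= a1K a2K; clear; lia.
- have [a1c1 /walk_uncons[c1x /walk_uncons[xu /walk_uncons[uy
    /walk_uncons[yc2 /walk_uncons[c2a2 _]]]]]] := walk_uncons ws.
  edges.
Qed.


(** Again the bound is attained: [u], [u'], three vertices between them and one in [D], so that [x]
    and [y'] are the ends in [K]. *)
Lemma theta_of_same_segment L x u M u' y' N S0 (D : seq T) d1 d2 :
  maximal ((L ++ x :: u :: M ++ u' :: y' :: N) :: S0) ->
  free_walk ((L ++ x :: u :: M ++ u' :: y' :: N) :: S0) D d1 d2 ->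
  e u d1 -> e u' d2 -> ~~ inK u -> ~~ inK u' ->
  exists a b u1 u2 u3 v1 v2 v3, theta_config a b u1 u2 u3 v1 v2 v3.
Proof.
move=> mS fw ud ud' uK uK'; have M3 := same_segment_gap mS fw ud ud'.
have [cD sD] := free_walk_count fw.
have := free_walk_bound mS fw; rewrite /= count_cat (segment_out (maximal_seg mS)).
rewrite size_cat /= size_cat /= => bound.
have [[L0 N0] [M3' D1]] : (size L = 0 /\ size N = 0) /\ (size M = 3 /\ size D = 1).
  move: M3 sD bound; move: (size L) (size M) (size N) (size D) (count _ (flatten S0)).
  by clear; lia.
case: L L0 mS fw {bound} => // _ mS fw.
case: N N0 mS fw => // _ mS fw.
case: M M3' {M3} mS fw => [|m1 [|m2 [|m3 [|? ?]]]] // _ mS fw.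
case: D D1 cD {sD} fw => [|d [|? ?]] // _ cD fw; rewrite /= in mS fw.
have Us := maximal_uniq mS.
have [wD _ fD KD] := fw.
have [? ?] := walk1E wD; subst d1 d2.
have dS := fD d (mem_head _ _); have dK := KD d (mem_head _ _).
have [a [b [ws aK bK cKs _]]] := maximal_seg mS.
have xK : inK x by rewrite (walk_head ws).
have yK : inK y' by rewrite (@walk_last _ _ [:: x; u; m1; m2; m3; u'] y' a b ws).
have xm := @claw_at [::] x u m1 [:: m2; m3; u'; y'] S0 d mS dS dK ud.
have my := @claw_at [:: x; u; m1; m2] m3 u' y' [::] S0 d mS dS dK ud'.
have U8 : uniq [:: d & [:: x; u; m1; m2; m3; u'; y']].
  by rewrite cons_uniq Us (mem_flatten1 dS).
exists x, y', u, d, u', m1, m2, m3; split.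
- by apply: (uniq_sub U8) => P; counts.
- by rewrite /= xK yK.
- apply: memE_outside => //; first by apply: (uniq_sub U8) => P; counts.
  by move: cKs cD; rewrite /= xK yK; clear; lia.
- have [xu /walk_uncons[um1 /walk_uncons[m12 /walk_uncons[m23
    /walk_uncons[m3u /walk_uncons[uy _]]]]]] := walk_uncons ws.
  edges.
Qed.

Lemma exists_maximal : exists S, maximal S.
Proof.
have bound S : system S -> coverage S <= 6.
  case=> _ US; rewrite /coverage -size_filter; apply: outside_size; first exact: filter_uniq.
  by move=> x; rewrite mem_filter => /andP[].
suff: forall n S, system S -> 6 - coverage S <= n -> exists S, maximal S.
  by move/(_ 6 [::]); apply.
elim=> [|n IHn] S sS cS.
  by exists S; split=> // S' /bound h; apply: leq_trans h _; move: cS; clear; lia.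
have [[S' [sS' lt]]|no] := boolp.EM (exists S', system S' /\ coverage S < coverage S').
  by apply: (IHn S') => //; have := bound S' sS'; move: lt cS; clear; lia.
exists S; split=> // S' sS'; rewrite leqNgt; apply/negP => lt.
by apply: no; exists S'.
Qed.

(** The cases are the positions of the two exits of an uncovered walk: both in [K] give a new
    segment, one in [K] the first shape, both on one segment the second shape, and exits on two
    segments allow merging. *)
Lemma nonham_config : ~ ham e ->
  (exists a1 a2 a3 c1 c2 c3 b1 b2 b3, EP_config a1 a2 a3 c1 c2 c3 b1 b2 b3) \/
  (exists a b u1 u2 u3 v1 v2 v3, theta_config a b u1 u2 u3 v1 v2 v3).
Proof.
move=> nh; have [S mS] := exists_maximal.
have [/existsP[d0 /andP[d0K d0S]]|/existsPn cov] :=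
    boolP [exists d, ~~ inK d && (d \notin flatten S)]; last first.
  case: nh; apply: (ham_system (maximal_system mS)) => x xK.
  by have := cov x; rewrite xK /= negbK.
have [D [d1 [d2 [c1 [c2 [[fw c12 dc1 dc2] [c1S c2S]]]]]]] := exists_free_walk mS d0K d0S.
have cd1 : e c1 d1 by rewrite e_sym.
have cd2 : e c2 d2 by rewrite e_sym.
have [c1K|c1K] := boolP (inK c1); have [c2K|c2K] := boolP (inK c2).
- by case: (two_K_contra mS fw c1K c2K c12).
- left; rewrite (negbTE c2K) /= in c2S.
  exact: (EP_of_attached mS (free_walk_rev fw) c2S c2K cd2 dc1 c1K).
- left; rewrite (negbTE c1K) /= in c1S.
  exact: (EP_of_attached mS fw c1S c1K cd1 dc2 c2K).
right; rewrite (negbTE c1K) /= in c1S; rewrite (negbTE c2K) /= in c2S.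
have [s sS c1s] := flattenP c1S; have [s' sS' c2s] := flattenP c2S.
have [S0 pS] := perm_eq_head sS.
have {mS} mS := maximal_perm pS mS; have {fw} fw := free_walk_perm pS fw.
have [ss'|ss'] := eqVneq s' s.
  rewrite ss' in c2s.
  wlog [A [B [E c2B]]] : D d1 d2 c1 c2 c1K c2K c12 {dc1 dc2 c1S c2S} cd1 cd2 c1s c2s fw /
      exists A B, s = A ++ c1 :: B /\ c2 \in B.
    move=> th; have : exists A B, s = A ++ c1 :: B.
      by case/splitPr: c1s => A B; exists A, B.
    case=> A [B E]; have := c2s; rewrite E mem_cat inE eq_sym (negbTE c12) /= => /orP[c2A|c2B].
      apply: (th (rev D) d2 d1 c2 c1) => //; first by rewrite eq_sym.
        exact: free_walk_rev.
      case/splitPr: c2A E => A1 A2 ->; exists A1, (A2 ++ c1 :: B); rewrite -catA; split=> //.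
      by rewrite mem_cat mem_head orbT.
    by apply: (th D d1 d2 c1 c2) => //; exists A, B.
  case/splitPr: c2B E => M B'; case/lastP: A => [|A x] E.
    have [a [b [ws aK _ _ _]]] := maximal_seg mS.
    by rewrite E in ws; rewrite (walk_head ws) aK in c1K.
  case: B' E => [|y N] E.
    have [a [b [ws _ bK _ _]]] := maximal_seg mS.
    have E' : s = rcons (rcons A x ++ c1 :: M) c2 by rewrite E cats1 rcons_cat rcons_cons.
    by rewrite E' in ws; rewrite (walk_last ws) bK in c2K.
  rewrite cat_rcons in E; rewrite E in mS fw.
  exact: (theta_of_same_segment mS fw cd1 cd2 c1K c2K).
exfalso; have s'S0 : s' \in S0.
  by have := sS'; rewrite (perm_mem pS) inE (negbTE ss').
have [S1 pS1] := perm_eq_head s'S0.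
have pS2 : perm_eq (s :: S0) (s :: s' :: S1) by rewrite perm_cons.
have {mS} mS := maximal_perm pS2 mS; have {fw} fw := free_walk_perm pS2 fw.
have pS3 : perm_eq [:: s, s' & S1] [:: s', s & S1] by apply/permP => P /=; clear; lia.
have sz1 := segment_size (maximal_seg mS) (maximal_uniq mS).
have mS' := maximal_perm pS3 mS.
have sz2 := segment_size (maximal_seg mS') (maximal_uniq mS').
have := free_walk_bound mS fw; rewrite /= !count_cat.
rewrite (segment_out (maximal_seg mS)) (segment_out (maximal_seg mS')).
have [_ sD] := free_walk_count fw => bound.
(* Of the six outside vertices, [D] takes at least one and the other segment at least two, so each
   interior has at most three. *)
have s5 : size s <= 5 /\ size s' <= 5.
  move: sz1 sz2 sD bound; move: (size s) (size s') (size D) (count _ (flatten S1)).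
  by clear; lia.
have [L [x [y [N sE]]]] := segment_inner (maximal_seg mS) c1s c1K.
have [L' [x' [y' [N' sE']]]] := segment_inner (maximal_seg mS') c2s c2K.
rewrite sE sE' in mS fw s5; case: s5 => s5 s5'.
exact: (two_segments_contra mS fw cd1 cd2 c1K c2K s5 s5').
Qed.


(** * Edges that the two shapes can carry *)

Hypothesis nh : ~ ham e.

Lemma segments_contra (S : seq (seq T)) (base outside : seq T) :
  uniq base -> (forall x, ~~ inK x -> x \in outside) ->
  (forall s, s \in S -> segment s) ->
  (forall P : pred T, count P (flatten S) <= count P base) ->
  (forall P : pred T, count P outside <= count P (flatten S)) -> False.
Proof.
move=> Ub out segS sub cov; apply: nh; apply: (@ham_system S).
  by split=> //; apply: uniq_sub Ub sub.
move=> x /out; rewrite -!has_pred1 !has_count => /leq_trans; apply; exact: cov.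
Qed.

Lemma segmentI a b s : walk e s a b -> inK a -> inK b -> count inK s = 2 -> 2 < size s ->
  segment s.
Proof. by exists a, b. Qed.

(** Together with [EP_config_swap] this generates all permutations of the indices, so each kind of
    forbidden edge is excluded once. *)
Lemma EP_config_rot a1 a2 a3 c1 c2 c3 b1 b2 b3 :
  EP_config a1 a2 a3 c1 c2 c3 b1 b2 b3 -> EP_config a2 a3 a1 c2 c3 c1 b2 b3 b1.
Proof.
case=> U9 aK out eds; split.
- by apply: (uniq_sub U9) => P; counts.
- by move: aK => /= /and4P[-> -> -> _].
- by move=> x; rewrite -out !inE; do 6 case: (x == _).
- by move: eds => /=; do ![case/andP=> ?] => _; edges.
Qed.

Lemma EP_config_swap a1 a2 a3 c1 c2 c3 b1 b2 b3 :
  EP_config a1 a2 a3 c1 c2 c3 b1 b2 b3 -> EP_config a2 a1 a3 c2 c1 c3 b2 b1 b3.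
Proof.
case=> U9 aK out eds; split.
- by apply: (uniq_sub U9) => P; counts.
- by move: aK => /= /and4P[-> -> -> _].
- by move=> x; rewrite -out !inE; do 6 case: (x == _).
- by move: eds => /=; do ![case/andP=> ?] => _; edges.
Qed.

Lemma outside_all (l : seq T) : (forall x, (x \in l) = ~~ inK x) -> all (predC inK) l.
Proof. by move=> out; apply/allP => x; rewrite out. Qed.

Ltac destruct_all H := move: (H) => /=; do ![case/andP=> ?] => _.

Ltac segment_tac x y :=
  apply: (@segmentI x y) => //;
  [edges | rewrite /=; repeat match goal with
     | H : is_true (inK _) |- _ => rewrite H; clear H
     | H : is_true (~~ inK _) |- _ => rewrite (negbTE H); clear H end; done].

Lemma EP_no_cc a1 a2 a3 c1 c2 c3 b1 b2 b3 :
  EP_config a1 a2 a3 c1 c2 c3 b1 b2 b3 -> ~~ e c1 c2.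
Proof.
case=> U9 aK out eds; apply/negP => c12.
destruct_all aK; destruct_all (outside_all out); destruct_all eds.
apply: (@segments_contra [:: [:: a3; c3; b3; b1; b2; c2; c1; a1]] _
  [:: c1; c2; c3; b1; b2; b3] U9); first by move=> x; rewrite out.
- by move=> s; rewrite inE => /eqP->; segment_tac a3 a1.
- by move=> P; counts.
- by move=> P; counts.
Qed.

Lemma EP_no_cb a1 a2 a3 c1 c2 c3 b1 b2 b3 :
  EP_config a1 a2 a3 c1 c2 c3 b1 b2 b3 -> ~~ e c1 b2.
Proof.
case=> U9 aK out eds; apply/negP => c12.
destruct_all aK; destruct_all (outside_all out); destruct_all eds.
apply: (@segments_contra [:: [:: a2; c2; b2; c1; b1; b3; c3; a3]] _
  [:: c1; c2; c3; b1; b2; b3] U9); first by move=> x; rewrite out.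
- by move=> s; rewrite inE => /eqP->; segment_tac a2 a3.
- by move=> P; counts.
- by move=> P; counts.
Qed.

Lemma EP_att_c a1 a2 a3 c1 c2 c3 b1 b2 b3 w :
  EP_config a1 a2 a3 c1 c2 c3 b1 b2 b3 -> inK w -> e c1 w -> w = a1.
Proof.
case=> U9 aK out eds wK cw.
destruct_all aK; destruct_all (outside_all out); destruct_all eds.
by apply: (@K_one c1) => //; rewrite e_sym.
Qed.

(** A second attachment [w] of [b1] differs from [a2] and [a3], as otherwise [c2] or [c3] would see
    [b1]. Then the disjoint segments [w b1 c1 a1] and [a2 c2 b2 b3 c3 a3] cover everything outside
    [K]. *)
Lemma EP_att_b a1 a2 a3 c1 c2 c3 b1 b2 b3 w :
  EP_config a1 a2 a3 c1 c2 c3 b1 b2 b3 -> inK w -> e b1 w -> w = a1.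
Proof.
move=> cfg wK bw.
have nbc : ~~ e c2 b1 := EP_no_cb (EP_config_swap cfg).
have nbc3 : ~~ e c3 b1 := EP_no_cb (EP_config_rot (EP_config_rot cfg)).
case: cfg => U9 aK out eds.
destruct_all aK; destruct_all (outside_all out); destruct_all eds.
destruct_all U9.
have [//|wa1] := eqVneq w a1; exfalso.
have nw x a : ~~ inK x -> x != b1 -> ~~ e x b1 -> e a x -> inK a -> w != a.
  move=> xK xb nxb ax aK'; apply: contraNneq nxb => wa.
  by apply: (K_att aK') => //; rewrite e_sym -wa // e_sym.
have neq x y : x \in [:: c2; c3] -> y = b1 -> x != y.
  move=> xc ->; have : uniq [:: c2; c3; b1] by apply: (uniq_sub U9) => P; counts.
  by rewrite /= !inE => /and3P[/norP[_ c2b] c3b _]; move: xc; rewrite !inE => /orP[]/eqP->.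
have wa2 : w != a2 by apply: (nw c2) => //; apply: neq; rewrite ?inE ?eqxx.
have wa3 : w != a3 by apply: (nw c3) => //; apply: neq; rewrite ?inE ?eqxx ?orbT.
have Uw : uniq (w :: [:: a1; a2; a3; c1; c2; c3; b1; b2; b3]).
  rewrite cons_uniq U9 andbT [w \in _](_ : _ = (w \in [:: a1; a2; a3])
    || (w \in [:: c1; c2; c3; b1; b2; b3])); last by rewrite -mem_cat.
  by rewrite out wK orbF !inE (negbTE wa1) (negbTE wa2).
apply: (@segments_contra [:: [:: w; b1; c1; a1]; [:: a2; c2; b2; b3; c3; a3]] _
  [:: c1; c2; c3; b1; b2; b3] Uw); first by move=> x; rewrite out.
- move=> s; rewrite !inE => /orP[]/eqP->; [segment_tac w a1 | segment_tac a2 a3].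
- by move=> P; counts.
- by move=> P; counts.
Qed.

Ltac nonedge := match goal with
  | H : is_true (e ?x ?x) |- _ => by rewrite e_irr in H
  | Hn : is_true (~~ e ?x ?y), Hp : is_true (e ?x ?y) |- _ => by rewrite Hp in Hn
  | Hn : is_true (~~ e ?x ?y), Hp : is_true (e ?y ?x) |- _ => by rewrite e_sym Hp in Hn
  end.

Definition EP_edges (a1 a2 a3 c1 c2 c3 b1 b2 b3 : T) : seq (T * T) :=
  [:: (a1, c1); (a1, b1); (c1, b1); (a2, c2); (a2, b2); (c2, b2);
      (a3, c3); (a3, b3); (c3, b3); (b1, b2); (b1, b3); (b2, b3)].

(** An upper bound on the edges, which makes the graph a spanning subgraph of [EP_n]. *)
Lemma EP_config_edges a1 a2 a3 c1 c2 c3 b1 b2 b3 z w :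
  EP_config a1 a2 a3 c1 c2 c3 b1 b2 b3 -> e z w ->
  [|| inK z && inK w, (z, w) \in EP_edges a1 a2 a3 c1 c2 c3 b1 b2 b3
    | (w, z) \in EP_edges a1 a2 a3 c1 c2 c3 b1 b2 b3].
Proof.
move=> cfg; set E := EP_edges _ _ _ _ _ _ _ _ _ => zw.
wlog zK : z w zw / ~~ inK z.
  move=> th; case/orP: (orbN (inK z)) => zK; last exact: th.
  rewrite zK; have [//|wK] := boolP (inK w).
  have wz : e w z by rewrite e_sym.
  by have := th w z wz wK; rewrite (negbTE wK) /= orbC.
have r1 := cfg; have r2 := EP_config_rot r1; have r3 := EP_config_rot r2.
have s1 := EP_config_swap r1; have s2 := EP_config_swap r2; have s3 := EP_config_swap r3.
rewrite (negbTE zK) /=.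
have [wK|wK] := boolP (inK w).
  have wz : e w z by rewrite e_sym.
  apply/orP; right; case: cfg => _ _ out _.
  move: zK zw; rewrite -out !inE => zl zw; move: zl.
  case/or4P=> [|||/or3P[]] /eqP zE; rewrite zE in zw *.
  - by rewrite (EP_att_c r1 wK zw) ?inE eqxx.
  - by rewrite (EP_att_c r2 wK zw) ?inE eqxx ?orbT.
  - by rewrite (EP_att_c r3 wK zw) ?inE eqxx ?orbT.
  - by rewrite (EP_att_b r1 wK zw) ?inE eqxx ?orbT.
  - by rewrite (EP_att_b r2 wK zw) ?inE eqxx ?orbT.
  - by rewrite (EP_att_b r3 wK zw) ?inE eqxx ?orbT.
case: cfg => _ _ out _.
have cc1 := EP_no_cc r1; have cc2 := EP_no_cc r2; have cc3 := EP_no_cc r3.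
have cb1 := EP_no_cb r1; have cb2 := EP_no_cb r2; have cb3 := EP_no_cb r3.
have cb4 := EP_no_cb s1; have cb5 := EP_no_cb s2; have cb6 := EP_no_cb s3.
move: zK wK zw; rewrite -!out !inE; clear -e_sym e_irr cc1 cc2 cc3 cb1 cb2 cb3 cb4 cb5 cb6.
by case/or4P=> [|||/or3P[]] /eqP->; case/or4P=> [|||/or3P[]] /eqP-> zw;
  rewrite ?inE ?xpair_eqE ?eqxx ?orbT //; exfalso; nonedge.
Qed.


(** Under the symmetries [swap] and [rev], the additional outside pairs fall into the orbits of
    [u1 v2], [u1 v3], [u2 v2], which are excluded, and of [u1 u3], which stays allowed. *)
Lemma theta_config_swap a b u1 u2 u3 v1 v2 v3 :
  theta_config a b u1 u2 u3 v1 v2 v3 -> theta_config a b v1 v2 v3 u1 u2 u3.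
Proof.
case=> U8 aK out eds; split=> //.
- by apply: (uniq_sub U8) => P; counts.
- by move=> x; rewrite -out !inE; do 6 case: (x == _).
- by destruct_all eds; edges.
Qed.

Lemma theta_config_rev a b u1 u2 u3 v1 v2 v3 :
  theta_config a b u1 u2 u3 v1 v2 v3 -> theta_config b a u3 u2 u1 v3 v2 v1.
Proof.
case=> U8 aK out eds; split.
- by apply: (uniq_sub U8) => P; counts.
- by move: aK => /= /and3P[-> -> _].
- by move=> x; rewrite -out !inE; do 6 case: (x == _).
- by destruct_all eds; edges.
Qed.

Lemma theta_no_12 a b u1 u2 u3 v1 v2 v3 :
  theta_config a b u1 u2 u3 v1 v2 v3 -> ~~ e u1 v2.
Proof.
case=> U8 aK out eds; apply/negP => uv.
destruct_all aK; destruct_all (outside_all out); destruct_all eds.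
apply: (@segments_contra [:: [:: a; v1; v2; u1; u2; u3; v3; b]] _
  [:: u1; u2; u3; v1; v2; v3] U8); first by move=> x; rewrite out.
- by move=> s; rewrite inE => /eqP->; segment_tac a b.
- by move=> P; counts.
- by move=> P; counts.
Qed.

Lemma theta_no_13 a b u1 u2 u3 v1 v2 v3 :
  theta_config a b u1 u2 u3 v1 v2 v3 -> ~~ e u1 v3.
Proof.
case=> U8 aK out eds; apply/negP => uv.
destruct_all aK; destruct_all (outside_all out); destruct_all eds.
apply: (@segments_contra [:: [:: a; v1; v2; v3; u1; u2; u3; b]] _
  [:: u1; u2; u3; v1; v2; v3] U8); first by move=> x; rewrite out.
- by move=> s; rewrite inE => /eqP->; segment_tac a b.
- by move=> P; counts.
- by move=> P; counts.
Qed.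

Lemma theta_no_22 a b u1 u2 u3 v1 v2 v3 :
  theta_config a b u1 u2 u3 v1 v2 v3 -> ~~ e u2 v2.
Proof.
case=> U8 aK out eds; apply/negP => uv.
destruct_all aK; destruct_all (outside_all out); destruct_all eds.
apply: (@segments_contra [:: [:: a; u1; v1; v2; u2; u3; v3; b]] _
  [:: u1; u2; u3; v1; v2; v3] U8); first by move=> x; rewrite out.
- by move=> s; rewrite inE => /eqP->; segment_tac a b.
- by move=> P; counts.
- by move=> P; counts.
Qed.

Lemma theta_att_1 a b u1 u2 u3 v1 v2 v3 w :
  theta_config a b u1 u2 u3 v1 v2 v3 -> inK w -> e u1 w -> w = a.
Proof.
case=> U8 aK out eds wK uw.
destruct_all aK; destruct_all (outside_all out); destruct_all eds.
by apply: (@K_one u1) => //; rewrite e_sym.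
Qed.

(** Attachment to [a] or [b] would make [u2] adjacent to [v1] or [v3]. Any other [w] in [K] gives
    the covering segment [w u2 u1 v1 v2 v3 u3 b]. *)
Lemma theta_att_2 a b u1 u2 u3 v1 v2 v3 w :
  theta_config a b u1 u2 u3 v1 v2 v3 -> inK w -> ~~ e u2 w.
Proof.
move=> cfg wK; apply/negP => uw.
have nv1 := theta_no_12 (theta_config_swap cfg).
have nv3 := theta_no_12 (theta_config_rev (theta_config_swap cfg)).
case: cfg => U8 aK out eds.
destruct_all aK; destruct_all (outside_all out); destruct_all eds.
have [u2v1 u2v3] : u2 != v1 /\ u2 != v3.
  have : uniq [:: u2; v1; v3] by apply: (uniq_sub U8) => P; counts.
  by rewrite /= !inE negb_or => /andP[/andP[-> ->]].
have wa : w != a.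
  apply: contraNneq nv1 => wa; rewrite e_sym.
  by apply: (@K_att a) => //; rewrite e_sym -wa.
have wb : w != b.
  apply: contraNneq nv3 => wb; rewrite e_sym.
  by apply: (@K_att b) => //; rewrite e_sym // -wb.
have Uw : uniq (w :: [:: a; b; u1; u2; u3; v1; v2; v3]).
  rewrite cons_uniq U8 andbT [w \in _](_ : _ = (w \in [:: a; b])
    || (w \in [:: u1; u2; u3; v1; v2; v3])); last by rewrite -mem_cat.
  by rewrite out wK orbF !inE (negbTE wa).
apply: (@segments_contra [:: [:: w; u2; u1; v1; v2; v3; u3; b]] _
  [:: u1; u2; u3; v1; v2; v3] Uw); first by move=> x; rewrite out.
- by move=> s; rewrite inE => /eqP->; segment_tac w b.
- by move=> P; counts.
- by move=> P; counts.
Qed.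

Definition theta_edges (a b u1 u2 u3 v1 v2 v3 : T) : seq (T * T) :=
  [:: (a, u1); (a, v1); (b, u3); (b, v3); (u1, v1); (u1, u2); (u2, u3); (u1, u3);
      (v1, v2); (v2, v3); (v1, v3); (u3, v3)].

Lemma theta_config_edges a b u1 u2 u3 v1 v2 v3 z w :
  theta_config a b u1 u2 u3 v1 v2 v3 -> e z w ->
  [|| inK z && inK w, (z, w) \in theta_edges a b u1 u2 u3 v1 v2 v3
    | (w, z) \in theta_edges a b u1 u2 u3 v1 v2 v3].
Proof.
move=> cfg; set E := theta_edges _ _ _ _ _ _ _ _ => zw.
wlog zK : z w zw / ~~ inK z.
  move=> th; case/orP: (orbN (inK z)) => zK; last exact: th.
  rewrite zK; have [//|wK] := boolP (inK w).
  have wz : e w z by rewrite e_sym.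
  by have := th w z wz wK; rewrite (negbTE wK) /= orbC.
have r1 := cfg; have r2 := theta_config_rev r1.
have s1 := theta_config_swap r1; have s2 := theta_config_swap r2.
rewrite (negbTE zK) /=.
have [wK|wK] := boolP (inK w).
  apply/orP; right; case: cfg => _ _ out _.
  move: zK zw; rewrite -out !inE => zl zw; move: zl.
  case/or4P=> [|||/or3P[]] /eqP zE; rewrite zE in zw *.
  - by rewrite (theta_att_1 r1 wK zw) ?inE eqxx.
  - by rewrite (negbTE (theta_att_2 r1 wK)) in zw.
  - by rewrite (theta_att_1 r2 wK zw) ?inE eqxx ?orbT.
  - by rewrite (theta_att_1 s1 wK zw) ?inE eqxx ?orbT.
  - by rewrite (negbTE (theta_att_2 s1 wK)) in zw.
  - by rewrite (theta_att_1 s2 wK zw) ?inE eqxx ?orbT.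
case: cfg => _ _ out _.
have h1 := theta_no_12 r1; have h2 := theta_no_12 r2.
have h3 := theta_no_12 s1; have h4 := theta_no_12 s2.
have h5 := theta_no_13 r1; have h6 := theta_no_13 s1; have h7 := theta_no_22 r1.
move: zK wK zw; rewrite -!out !inE; clear -e_sym e_irr h1 h2 h3 h4 h5 h6 h7.
by case/or4P=> [|||/or3P[]] /eqP->; case/or4P=> [|||/or3P[]] /eqP-> zw;
  rewrite ?inE ?xpair_eqE ?eqxx ?orbT //; exfalso; nonedge.
Qed.

End Segments.

(** * A large clique from the degree sum *)

Section BigClique.
Variables (T : finType) (e : rel T).
Hypotheses (e_sym : symmetric e) (e_irr : irreflexive e).
Hypotheses (cf : clawfree e) (df : diamond_free e).

Definition nbr (v : T) : {set T} := [set w | e v w].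

(** Here [X + 1] is the order of the clique, [s] the number of vertices outside and [Y] the size of
    the smaller side. The estimate is tight at [s = Y = 7], [n = 32], where both sides are 625. *)
Lemma degree_arith n X Y s : 33 <= n -> n = X + 1 + s -> Y <= X -> Y <= s ->
  (n - 7) ^ 2 <= X * X + (s - Y) + Y * s -> s <= 6.
Proof.
move=> n33 nE YX Ys H; rewrite leqNgt; apply/negP => s7.
have [k nk] : exists k, n = k + 33 by exists (n - 33); rewrite subnK.
have Hk : (k + 26) ^ 2 <= X * X + (s - Y) + Y * s.
  by apply: leq_trans H; rewrite nk leq_sqr; clear; lia.
have [sX|Xs] := leqP s X.
  have H1 : (s - Y) + Y * s <= s * s by nia.
  (* This is [(s - 7)(X - 7) >= 0]; with [X + s = n - 1] it bounds [X^2 + s^2] by its value at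
     [s = 7]. *)
  have H2 : 7 * s + 7 * X <= s * X + 49 by nia.
  nia.
have H1 : (s - Y) + Y * s <= s + X * s - X by nia.
nia.
Qed.

Lemma sum_bool_card (A : {set T}) (P : pred T) :
  \sum_(r in A) (P r : nat) = #|[set r in A | P r]|.
Proof.
rewrite -sum1_card big_mkcond [RHS]big_mkcond; apply: eq_bigr => r _.
by rewrite inE; case: (r \in A); case: (P r).
Qed.

Section Sides.
Variables (v : T) (X Y : {set T}).
Hypotheses (XY : nbr v = X :|: Y) (dXY : [disjoint X & Y]) (X0 : 0 < #|X|).
Hypotheses (Xc : forall a b, a \in X -> b \in X -> a != b -> e a b).
Hypotheses (Yc : forall a b, a \in Y -> b \in Y -> a != b -> e a b).
Hypotheses (nXY : forall a b, a \in X -> b \in Y -> ~~ e a b).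
Hypothesis YX : #|Y| <= #|X|.

Let K := v |: X.

Let vX : v \notin X.
Proof.
apply/negP => h; have : v \in nbr v by rewrite XY inE h.
by rewrite inE e_irr.
Qed.

Lemma side_nbr x : x \in X -> e v x.
Proof.
move=> xX; have : x \in nbr v by rewrite XY inE xX.
by rewrite inE.
Qed.

Lemma side_nbr' y : y \in Y -> e v y.
Proof.
move=> yY; have : y \in nbr v by rewrite XY inE yY orbT.
by rewrite inE.
Qed.

Lemma big_clique a b : a \in K -> b \in K -> a != b -> e a b.
Proof.
rewrite !inE => /predU1P[->|aX] /predU1P[->|bX] ab.
- by rewrite eqxx in ab.
- exact: side_nbr.
- by rewrite e_sym side_nbr.
- exact: Xc.
Qed.

(** Two neighbours in [K] spread to all of [K] by diamond-freeness. Then [r] sees [v], so it lies in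
    [Y], yet it also sees [X]. *)
Lemma big_clique_one_nbr r a b : r \notin K -> a \in K -> b \in K -> e r a -> e r b -> a = b.
Proof.
move=> rK aK bK ra rb; have [//|ab] := eqVneq a b; exfalso.
have rall k : k \in K -> e r k.
  move=> kK; have [->//|ka] := eqVneq k a; have [->//|kb] := eqVneq k b.
  have rk : r != k by apply: contraNneq rK => ->.
  apply: (df (z := a) (u := b)) => //.
  - exact: big_clique.
  - by rewrite e_sym.
  - by apply: big_clique => //; rewrite eq_sym.
  - by rewrite e_sym.
  - by apply: big_clique => //; rewrite eq_sym.
have /card_gt0P[x xX] := X0.
have rX : r \notin X by apply: contra rK; rewrite !inE => ->; rewrite orbT.
have rY : r \in Y.
  have : r \in nbr v by rewrite inE e_sym rall // !inE eqxx.
  by rewrite XY inE (negbTE rX).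
have := nXY xX rY; rewrite e_sym rall //; by rewrite !inE xX orbT.
Qed.

(** Another vertex [k] of [K] is the third leg at [a]: it sees neither [r] nor [r'], as each has
    only [a] as neighbour in [K]. *)
Lemma big_clique_common_nbr a r r' : a \in K -> r \notin K -> r' \notin K ->
  e a r -> e a r' -> r != r' -> e r r'.
Proof.
move=> aK rK rK' ar ar' rr'.
have [k kK ka] : exists2 k, k \in K & k != a.
  have /card_gt0P[x xX] := X0; have [va|va] := eqVneq v a.
    exists x; rewrite ?inE ?xX ?orbT //; apply: contraNneq vX => xa.
    by rewrite va -xa.
  by exists v; rewrite // !inE eqxx.
have ak : e a k by apply: big_clique => //; rewrite eq_sym.
have kr : k != r by apply: contraNneq rK => <-.
have kr' : k != r' by apply: contraNneq rK' => <-.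
have nkr x : x \notin K -> e a x -> ~~ e k x.
  move=> xK ax; apply: contra ka => kx; apply/eqP.
  by apply: (big_clique_one_nbr xK) => //; rewrite e_sym.
have := cf ak ar ar' kr kr' rr'.
by rewrite (negbTE (nkr r rK ar)) (negbTE (nkr r' rK' ar')).
Qed.

(** Edges from [X] to the outside are counted from their outer ends: at most one for each vertex,
    and none for those of [Y]. A vertex of [Y] sees [v] and only vertices outside [K], itself
    excepted. *)
Lemma big_degree_sum : \sum_(u in nbr v) #|nbr u| <=
  #|X| * #|X| + (#|~: K| - #|Y|) + #|Y| * #|~: K|.
Proof.
have YK : Y \subset ~: K.
  apply/fintype.subsetP => y yY; rewrite !inE negb_or; apply/andP; split.
    by apply: contraTneq (side_nbr' yY) => ->; rewrite e_irr.
  by apply: contraL yY => yX; have := disjointFr dXY yX => ->.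
have -> : \sum_(u in nbr v) #|nbr u| = \sum_(u in X) #|nbr u| + \sum_(u in Y) #|nbr u|.
  rewrite -bigU //; apply: eq_bigl => u; by rewrite XY !inE.
apply: leq_add; last first.
  rewrite -sum_nat_const; apply: leq_sum => u uY.
  have uK : u \in ~: K by apply: (fintype.subsetP YK).
  have sub : nbr u \subset v |: (~: K :\ u).
    apply/fintype.subsetP => w; rewrite !inE => uw; have [//|/= _] := eqVneq w v.
    have [wX|_] := boolP (w \in X); first by rewrite e_sym (negbTE (nXY wX uY)) in uw.
    by rewrite !andbT; apply: contraTneq uw => ->; rewrite e_irr.
  apply: leq_trans (subset_leq_card sub) _.
  rewrite cardsU1 (cardsD1 u (~: K)) uK leq_add2r; exact: leq_b1.
have deg u : u \in X -> #|nbr u| <= #|X| + #|nbr u :&: ~: K|.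
  move=> uX; rewrite -(cardsID K) finset.setDE leq_add2r.
  have -> : #|X| = #|K :\ u|.
    have := cardsD1 u K; rewrite /K cardsU1 vX !inE uX orbT; clear; lia.
  apply: subset_leq_card; apply/fintype.subsetP => w; rewrite !inE => /andP[uw ->].
  by rewrite andbT; apply: contraTneq uw => ->; rewrite e_irr.
apply: (@leq_trans (\sum_(u in X) (#|X| + #|nbr u :&: ~: K|))).
  exact: leq_sum.
rewrite big_split /= sum_nat_const leq_add2l.
have -> : \sum_(u in X) #|nbr u :&: ~: K| = \sum_(r in ~: K) \sum_(u in X) e u r.
  rewrite exchange_big /=; apply: eq_bigr => u _.
  by rewrite sum_bool_card; apply: eq_card => r; rewrite !inE andbC.
apply: (@leq_trans (\sum_(r in ~: K) (r \notin Y))).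
  apply: leq_sum => r rK; have rK' : r \notin K by rewrite inE in rK.
  rewrite sum_bool_card; have [rY|rY] /= := boolP (r \in Y).
    rewrite leqn0 cards_eq0; apply/eqP/finset.setP => u; rewrite !inE.
    by apply/negbTE; apply/negP => /andP[uX]; apply/negP; apply: nXY.
  apply/card_le1_eqP => a b; rewrite !inE => /andP[aX ar] /andP[bX br].
  by apply: (big_clique_one_nbr rK'); rewrite ?inE ?aX ?bX ?orbT // e_sym.
rewrite sum_bool_card -(cardsID Y (~: K)) (finset.setIidPr YK) addKn.
by apply: subset_leq_card; apply/fintype.subsetP => r; rewrite !inE andbC.
Qed.
End Sides.

Definition big_clique_props (K : {set T}) :=
  [/\ forall a b, a \in K -> b \in K -> a != b -> e a b,
      forall r a b, r \notin K -> a \in K -> b \in K -> e r a -> e r b -> a = b,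
      forall a r r', a \in K -> r \notin K -> r' \notin K -> e a r -> e a r' ->
        r != r' -> e r r' & #|~: K| <= 6].

Lemma exists_big_clique v : 33 <= #|T| ->
  (#|T| - 7) ^ 2 <= \sum_(u in nbr v) #|nbr u| ->
  exists K : {set T}, big_clique_props K.
Proof.
move=> n33 big.
have sides (X Y : {set T}) : nbr v = X :|: Y -> [disjoint X & Y] -> 0 < #|X| ->
    (forall a b, a \in X -> b \in X -> a != b -> e a b) ->
    (forall a b, a \in Y -> b \in Y -> a != b -> e a b) ->
    (forall a b, a \in X -> b \in Y -> ~~ e a b) -> #|Y| <= #|X| ->
    exists K : {set T}, big_clique_props K.
  move=> XY dXY X0 Xc Yc nXY YX; exists (v |: X).
  split; [exact: (big_clique XY) | exact: (big_clique_one_nbr XY) | exact: (big_clique_common_nbr XY) |].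
  have sumb := leq_trans big (big_degree_sum XY dXY X0 Xc nXY).
  have vX : v \notin X.
    by apply/negP => vX; have := side_nbr XY vX; rewrite e_irr.
  have YK : #|Y| <= #|~: (v |: X)|.
    apply: subset_leq_card; apply/fintype.subsetP => y yY; rewrite !inE negb_or.
    rewrite (contraTneq _ (side_nbr' XY yY)) /=; last by move=> ->; rewrite e_irr.
    by apply: contraL yY => yX; rewrite (disjointFr dXY yX).
  apply: (degree_arith n33 _ YX YK sumb).
  by rewrite -(cardsC (v |: X)) cardsU1 vX addnC; clear; lia.
have [x vx] : exists x, e v x.
  apply/existsP; apply: contraT => /existsPn no.
  move: big; rewrite big_pred0 => [|u]; last by rewrite inE (negbTE (no u)).
  by rewrite leqn0 expn_eq0 andbT subn_eq0 leqNgt (leq_trans _ n33).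
(* Inside [N(v)], diamond-freeness makes [X] a clique without edges to the rest, and claw-freeness
   makes the rest a clique. The larger side joins [v] to form [K]. *)
pose X := [set w in nbr v | (w == x) || e w x].
pose Y := nbr v :\: X.
have XY : nbr v = X :|: Y.
  apply/finset.setP => w; rewrite !inE.
  by case: (e v w); rewrite ?andbF ?orbF ?andbT ?orbN.
have dXY : [disjoint X & Y].
  rewrite finset.disjoints_subset; apply/fintype.subsetP => w.
  by rewrite !inE => /andP[-> ->].
have Xx w : w \in X -> e v w /\ ((w == x) || e w x) by rewrite !inE => /andP[].
have Yx w : w \in Y -> [/\ e v w, w != x & ~~ e w x].
  by rewrite !inE => /andP[+ vw]; rewrite vw /= negb_or => /andP[].
have Xc a b : a \in X -> b \in X -> a != b -> e a b.
  move=> /Xx[va /predU1P[ax|ax]] /Xx[vb /predU1P[bx|bx]] ab.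
  - by rewrite ax bx eqxx in ab.
  - by rewrite ax e_sym.
  - by rewrite bx.
  - by apply: (df vx va vb) => //; rewrite e_sym.
have Yc a b : a \in Y -> b \in Y -> a != b -> e a b.
  move=> /Yx[va ax nax] /Yx[vb bx nbx] ab.
  have := cf va vb vx ab ax bx; by rewrite (negbTE nax) (negbTE nbx) !orbF.
have nXY a b : a \in X -> b \in Y -> ~~ e a b.
  move=> /Xx[va ax] /Yx[vb bx nbx]; apply: contra nbx => eab.
  case/predU1P: ax => [<-|ax]; first by rewrite e_sym.
  by rewrite e_sym; apply: (df va vx vb) => //; rewrite eq_sym.
have xX : x \in X by rewrite !inE vx eqxx.
have [YX|XlY] := leqP #|Y| #|X|.
  by apply: (sides X Y) => //; apply/card_gt0P; exists x.
apply: (sides Y X) => //.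
- by rewrite finset.setUC.
- by rewrite disjoint_sym.
- exact: leq_trans XlY.
- by move=> a b aY bX; rewrite e_sym; apply: nXY.
- exact: ltnW.
Qed.
End BigClique.

(** * Spectral comparison *)

Section Subharmonic.
Import Order.TTheory GRing.Theory Num.Theory.
Local Open Scope ring_scope.
Variables (R : realFieldType) (T : finType).
Implicit Types (e : rel T) (y w : T -> R).

(* The absolute value of an eigenvector is subharmonic for every [rho] up to the
   absolute value of its eigenvalue; unlike an eigenvector, it stays so when
   edges are added. *)
Definition subharmonic e (rho : R) y :=
  [/\ forall v, 0 <= y v, exists v, y v != 0 &
      forall v, rho * y v <= \sum_(u | e v u) y u].

Lemma subharmonic_sub e e' rho y : subrel e e' -> subharmonic e rho y -> subharmonic e' rho y.
Proof.
move=> sub [y0 yn0 yrho]; split=> // v; apply: le_trans (yrho v) _.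
rewrite big_mkcond [leRHS]big_mkcond /=; apply: ler_sum => u _.
by case: ifP => [/sub->//|_]; case: ifP.
Qed.

Lemma sum_edges_exchange e y w : symmetric e ->
  \sum_x w x * (\sum_(t | e x t) y t) = \sum_t y t * (\sum_(x | e t x) w x).
Proof.
move=> e_sym.
transitivity (\sum_x \sum_(t | e x t) w x * y t).
  by apply: eq_bigr => x _; rewrite mulr_sumr.
rewrite (exchange_big_dep xpredT) //=; apply: eq_bigr => t _.
rewrite mulr_sumr; apply: eq_big => [x|x _]; first by rewrite e_sym.
by rewrite mulrC.
Qed.

(** With [A] the adjacency operator, [rho <w, y> <= <w, A y> = <A w, y> < rho <w, y>]; strictness
    comes from a vertex where [y] is positive. *)
Lemma strict_weight_contra e rho y w : symmetric e -> subharmonic e rho y ->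
  (forall v, 0 < w v) -> (forall v, \sum_(u | e v u) w u < rho * w v) -> False.
Proof.
move=> e_sym [y0 [v yv] yrho] w0 wrho.
have : \sum_x w x * (rho * y x) <= \sum_x w x * (\sum_(t | e x t) y t).
  by apply: ler_sum => x _; rewrite ler_pM2l.
rewrite sum_edges_exchange // leNgt => /negP; apply.
have le_term x : y x * (\sum_(u | e x u) w u) <= w x * (rho * y x).
  by rewrite mulrCA mulrA [leRHS]mulrC ler_wpM2l // ltW.
rewrite (bigD1 v) //= [ltRHS](bigD1 v) //=; apply: ltr_leD; last exact: ler_sum.
by rewrite mulrCA mulrA [ltRHS]mulrC ltr_pM2l // lt_def yv y0.
Qed.

(* Pair the defect of [y] with the positive eigenvector [w] of the larger graph. *)
Lemma subharmonic_rigid e e' rho y w : symmetric e -> symmetric e' -> subrel e e' ->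
  (forall D : pred T, (exists d, D d) -> (exists c, ~~ D c) ->
     exists d c, [/\ D d, ~~ D c & e d c]) ->
  subharmonic e rho y -> (forall v, 0 < w v) ->
  (forall v, \sum_(u | e' v u) w u = rho * w v) -> e =2 e'.
Proof.
move=> e_sym e'_sym sub conn [y0 yn0 yrho] w0 wrho.
pose dy x := \sum_(t | e x t) y t - rho * y x.
pose de t := \sum_(x | e' t x && ~~ e t x) w x.
have dy0 x : 0 <= dy x by rewrite subr_ge0.
have de0 t : 0 <= de t by apply: sumr_ge0 => x _; apply: ltW.
have deE t : \sum_(x | e t x) w x = rho * w t - de t.
  rewrite -wrho [in RHS](bigID (e t)) /= /de addrK; apply: eq_bigl => x.
  by case etx: (e t x); rewrite ?andbT ?andbF ?(sub _ _ etx).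
(* Exchanging the two sums cancels all but the defects [dy] of [y] and [de] of [w]. Both pairings
   are nonnegative, so all their terms vanish. *)
have eq0 : \sum_x w x * dy x + \sum_t y t * de t = 0.
  rewrite /dy; under eq_bigr do rewrite mulrBr.
  rewrite sumrB (sum_edges_exchange y w e_sym).
  under eq_bigr do rewrite deE mulrBr.
  rewrite sumrB addrAC subrK -sumrB big1 // => t _; ring.
have wdy0 x : 0 <= w x * dy x by apply: mulr_ge0 => //; apply: ltW.
have yde0 t : 0 <= y t * de t by apply: mulr_ge0.
have /andP[/eqP sdy /eqP sde] : (\sum_x w x * dy x == 0) && (\sum_t y t * de t == 0).
  by rewrite -paddr_eq0 ?sumr_ge0 // eq0.
have dyE x : dy x = 0.
  apply/eqP; have := w0 x; rewrite lt_def => /andP[/negbTE wx _].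
  have := sdy => /eqP; rewrite psumr_eq0 // => /allP/(_ x (mem_index_enum _)).
  by rewrite mulf_eq0 wx.
(* Once [dy] vanishes, a zero of [y] forces zeros at all its neighbours, so connectedness makes [y]
   positive everywhere. *)
have yP v : y v != 0.
  apply: contraT; rewrite negbK => yv0.
  have [||d [c [yd yc dc]]] := conn (fun v => y v != 0).
  - exact: yn0.
  - by exists v; rewrite negbK.
  rewrite negbK in yc; have := dyE c; rewrite /dy (eqP yc) mulr0 subr0 => /eqP.
  rewrite psumr_eq0 => [|u _]; last exact: y0.
  by move=> /allP/(_ d (mem_index_enum _)); rewrite e_sym dc (negbTE yd).
move=> x t; apply/idP/idP; first exact: sub.
move=> e'xt; apply: contraT => nxt.
have := sde => /eqP; rewrite psumr_eq0 // => /allP/(_ x (mem_index_enum _)).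
rewrite mulf_eq0 (negbTE (yP x)) /= psumr_eq0 => [|u _]; last exact: ltW.
move=> /allP/(_ t (mem_index_enum _)); rewrite e'xt nxt /=.
by have := w0 t; rewrite lt_def => /andP[/negbTE->].
Qed.

(* Apply the inequality twice at a maximum of [y]. *)
Lemma degree_sum e rho y : symmetric e -> 0 <= rho -> subharmonic e rho y ->
  exists v, rho ^+ 2 <= \sum_(u | e v u) (#|nbr e u|)%:R.
Proof.
move=> e_sym rho0 [y0 [v0 yv0] yrho].
pose v := [arg max_(i > v0) y i]%O.
have ymax u : y u <= y v by rewrite /v; case: arg_maxP => // i _; apply.
have yv : 0 < y v.
  by apply: lt_le_trans (ymax v0); rewrite lt_def yv0 y0.
exists v; rewrite -(ler_pM2r yv) mulr_suml.
apply: (@le_trans _ _ (rho * \sum_(u | e v u) y u)).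
  by rewrite expr2 -mulrA ler_wpM2l.
rewrite mulr_sumr; apply: ler_sum => u _; apply: le_trans (yrho u) _.
rewrite -sumr_const mulr_suml; under [leRHS]eq_bigr do rewrite mul1r.
rewrite [leRHS](eq_bigl (e u)) => [|t]; last by rewrite inE.
exact: ler_sum.
Qed.
End Subharmonic.

(** * From the spectral radius to functions on vertices *)

Section SpectralRadius.
Import Order.TTheory GRing.Theory Num.Theory.
Local Open Scope ring_scope.
Variable R : realType.

Lemma sum_enum_val (T : finType) (F : T -> R) :
  \sum_(i < #|T|) F (enum_val i) = \sum_(u : T) F u.
Proof. by rewrite [RHS](reindex (@enum_val T T)) //; apply/onW_bij/enum_val_bij. Qed.

Lemma mul_adjacency (G : sgraph) (v : 'rV[R]_#|G|) j :
  (v *m adjacency R G) 0 j = \sum_(u | adj (enum_val j) u) v 0 (enum_rank u).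
Proof.
rewrite mxE [RHS]big_mkcond -[RHS]sum_enum_val; apply: eq_bigr => i _.
rewrite mxE enum_valK adj_sym.
by case: (adj _ _); rewrite ?mulr1 ?mulr0.
Qed.

Lemma eigenvalue_adjP (G : sgraph) x : eigenvalue (adjacency R G) x <->
  exists2 y : G -> R, exists v, y v != 0 & forall v, \sum_(u | adj v u) y u = x * y v.
Proof.
split=> [/eigenvalueP[v vA v0]|[y [v0 yv0] yx]].
  exists (fun u => v 0 (enum_rank u)) => [|u].
    have /rV0Pn[i vi] := v0.
    by exists (enum_val i); rewrite enum_valK.
  have := congr1 (fun w : 'rV_ _ => w 0 (enum_rank u)) vA.
  by rewrite mul_adjacency enum_rankK mxE.
apply/eigenvalueP; exists (\row_i y (enum_val i)).
  apply/rowP => j; rewrite mul_adjacency !mxE -yx; apply: eq_bigr => u _.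
  by rewrite mxE enum_rankK.
by apply/rV0Pn; exists (enum_rank v0); rewrite mxE enum_rankK.
Qed.

Lemma poly_root_list (p : {poly R}) : p != 0 -> exists s : seq R, forall x, root p x -> x \in s.
Proof.
have [n] := ubnP (size p); elim: n p => // n IHn p; rewrite ltnS => sp p0.
have [[x px]|no] := boolp.EM (exists x, root p x); last first.
  by exists [::] => x px; case: no; exists x.
have [q pE] := factor_theorem p x px.
have q0 : q != 0 by apply: contraNneq p0 => q0; rewrite pE q0 mul0r.
have [|//|s sP] := IHn q.
  by move: sp; rewrite pE size_Mmonic ?monicXsubC // size_XsubC addn2.
exists (x :: s) => z; rewrite pE rootM root_XsubC inE => /orP[/sP->|->//].
by rewrite orbT.
Qed.

Lemma list_max (s : seq R) (P : R -> Prop) : (forall x, P x -> x \in s) -> (exists x, P x) ->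
  exists2 m, P m & forall x, P x -> x <= m.
Proof.
elim: s P => [|a s IHs] P sub [x Px]; first by have := sub x Px.
have [[z Pz]|no] := boolp.EM (exists z, P z /\ z != a).
  have [t [/sub + ta]||m [Pm ma] mmax] := IHs (fun z => P z /\ z != a).
  - by rewrite inE (negbTE ta).
  - by exists z.
  have [Pa|nPa] := boolp.EM (P a); last first.
    exists m => // t Pt; apply: mmax; split=> //.
    by apply/eqP => ta; rewrite ta in Pt.
  have [am|ma'] := leP a m; [exists m | exists a] => // t Pt;
    have [->//|ta] := eqVneq t a.
  - exact: mmax.
  - by apply: le_trans (ltW ma'); apply: mmax.
have Pa t : P t -> t = a by move=> Pt; apply/eqP; apply: contraT => ta; case: no; exists t.
by exists a => [|t /Pa->//]; rewrite -(Pa x Px).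
Qed.

Lemma spectral_max (G : sgraph) : (exists x, eigenvalue (adjacency R G) x) ->
  eigenvalue (adjacency R G) (spectral_radius R G) /\
  forall x, eigenvalue (adjacency R G) x -> x <= spectral_radius R G.
Proof.
move=> [x0 ex0]; set E := [set x : R | eigenvalue (adjacency R G) x]%classic.
have p0 : char_poly (adjacency R G) != 0 by rewrite monic_neq0 ?char_poly_monic.
have [s sP] := poly_root_list p0.
have [|m Em mmax] := @list_max s (fun x => eigenvalue (adjacency R G) x) _ (ex_intro _ x0 ex0).
  by move=> x; rewrite eigenvalue_root_char; apply: sP.
have supE : spectral_radius R G = m.
  apply/le_anti/andP; split; first by apply: ge_sup; [exists m | exact: mmax].
  by apply: ub_le_sup => //; exists m; exact: mmax.
by rewrite supE.
Qed.

Lemma spectral_subharmonic (G : sgraph) rho : 0 < rho -> rho <= spectral_radius R G ->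
  exists y : G -> R, subharmonic (@adj G) rho y.
Proof.
move=> rho0 le_rho.
have ex : exists x, eigenvalue (adjacency R G) x.
  have [//|no] := boolp.EM (exists x, eigenvalue (adjacency R G) x).
  (* Without eigenvalues the supremum is taken over the empty set and has the default value 0, below
     [rho]. *)
  have : spectral_radius R G <= 0.
    rewrite /spectral_radius (_ : [set x | _]%classic = set0) ?sup0 //.
    by apply/seteqP; split=> // x ex; apply: no; exists x.
  by rewrite leNgt (lt_le_trans rho0 le_rho).
have [/eigenvalue_adjP[y [v yv] yx] _] := spectral_max ex.
exists (fun u => `|y u|); split=> [//||u]; first by exists v; rewrite normr_eq0.
apply: (@le_trans _ _ `|spectral_radius R G * y u|).
  by rewrite normrM ler_wpM2r ?(le_trans le_rho) ?ler_norm.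
by rewrite -yx ler_norm_sum.
Qed.

Lemma spectral_ge (G : sgraph) rho (w : G -> R) : (exists v, w v != 0) ->
  (forall v, \sum_(u | adj v u) w u = rho * w v) -> rho <= spectral_radius R G.
Proof.
move=> w0 wrho; have er : eigenvalue (adjacency R G) rho by apply/eigenvalue_adjP; exists w.
by have [|_ ->] // := @spectral_max G; exists rho.
Qed.
End SpectralRadius.

(** * A positive eigenvector of the extremal graph *)

Section EPEigenvector.
Import Order.TTheory GRing.Theory Num.Theory.
Local Open Scope ring_scope.
Variable R : rcfType.

(* Characteristic equation of the quotient of [EP_n] by the orbits
   [Q \ {a_i}], [{a_i}], [{b_i}], [{c_i}], with [k = n - 6] the order of [Q]. *)
Definition EP_quartic (k rho : R) :=
  (rho - k + 4) * ((rho - 2) * (rho ^+ 2 - 2 * rho - 1) - 2 * rho)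
    = 3 * (k - 3) * (rho ^+ 2 - 2 * rho - 1).

(** The intermediate value theorem between [k - 1], the spectral radius of the clique [Q] alone, and
    [k]. *)
Lemma EP_quartic_root (k : R) : 27 <= k ->
  exists rho, [/\ k - 1 < rho, rho <= k & EP_quartic k rho].
Proof.
move=> k27.
pose q : {poly R} := 'X ^+ 2 - 2%:P * 'X - 1.
pose p : {poly R} := ('X - (k - 4)%:P) * (('X - 2%:P) * q - 2%:P * 'X) - (3 * (k - 3))%:P * q.
have pE x : p.[x] = (x - k + 4) * ((x - 2) * (x ^+ 2 - 2 * x - 1) - 2 * x)
    - 3 * (k - 3) * (x ^+ 2 - 2 * x - 1).
  by rewrite /p /q !hornerE /=; ring.
have p_lo : p.[k - 1] = - 6 * (k - 1) by rewrite pE; ring.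
have p_hi : 0 <= p.[k].
  rewrite pE (_ : _ - _ = (k + 1) * (k ^+ 2 - 2 * k - 1) - 8 * k); last by ring.
  nra.
have [||rho /andP[lo hi] /rootP pr] := @poly_ivt _ p (k - 1) k; first by lra.
  by rewrite p_lo p_hi andbT; lra.
exists rho; split=> //.
  rewrite lt_def lo andbT; apply: contraTneq isT => rE.
  by have := pr; rewrite rE p_lo => h; suff : False by []; lra.
by apply/eqP; rewrite -subr_eq0 -pE pr.
Qed.

Lemma EP_quad_gt0 (rho : R) : 26 < rho -> 0 < rho ^+ 2 - 2 * rho - 1.
Proof. by move=> rho26; nra. Qed.

Section Vector.
Variables (n : nat) (k rho : R).
Hypotheses (n33 : (33 <= n)%N) (kE : k = (n - 6)%:R).
Hypotheses (rho_lo : k - 1 < rho) (rho_hi : rho <= k) (rhoE : EP_quartic k rho).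

(** With weight 1 on the ordinary clique vertices, their equation gives [A]; the equations
    [rho B = A + 2 B + C] and [rho C = A + B] at [b_i] and [c_i] give [B] and [C]. The equation at
    [a_i] is then the quartic. *)
Let q := rho ^+ 2 - 2 * rho - 1.
Let A := (rho - k + 4) / 3.
Let B := A * (rho + 1) / q.
Let C := A * (rho - 1) / q.

Let k27 : 27 <= k. Proof. by rewrite kE ler_nat; clear -n33; lia. Qed.
Let rho26 : 26 < rho.
Proof. by apply: le_lt_trans rho_lo; rewrite lerBrDr (_ : 26 + 1 = 27) // ; ring. Qed.
Let q0 : 0 < q. Proof. exact: EP_quad_gt0. Qed.
Let A0 : 0 < A. Proof. by have h := rho_lo; rewrite /A; lra. Qed.

Definition EP_weight (v : EP n) : R :=
  match v with
  | inl u => if (u < 3)%N then A else 1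
  | inr (inl _) => B
  | inr (inr _) => C
  end.

Lemma EP_weight_gt0 v : 0 < EP_weight v.
Proof.
have h := rho26; have rho0 : 1 < rho by lra.
case: v => [u|[i|i]] /=; first by case: ifP.
  by rewrite divr_gt0 // mulr_gt0 //; lra.
by rewrite divr_gt0 // mulr_gt0 //; lra.
Qed.

Lemma sum_EP_clique : \sum_(j < n - 6) (if (j < 3)%N then A else 1) = k + 3 * (A - 1).
Proof.
rewrite -(big_mkord xpredT (fun j => if (j < 3)%N then A else 1)).
rewrite (@big_cat_nat _ _ _ 3) //=; last by clear -n33; lia.
rewrite (eq_big_nat _ _ (F2 := fun=> A)); last by move=> i /andP[_ ->].
rewrite [X in _ + X](eq_big_nat _ _ (F2 := fun=> 1)); last first.
  by move=> i /andP[h _]; rewrite ltnNge h.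
rewrite !sumr_const_nat subn0 natrB -?kE; last by clear -n33; lia.
ring.
Qed.

Lemma sum_ord3 (m : nat) (x : R) :
  \sum_(i < 3 | m == i :> nat) x = if (m < 3)%N then x else 0.
Proof.
rewrite big_mkcond !big_ord_recl big_ord0 /= /bump /=.
by case: m => [|[|[|m]]]; rewrite /= ?addr0 ?add0r.
Qed.

Lemma sum_ord3_neq (i : 'I_3) (x : R) : \sum_(j < 3 | i != j) x = 2 * x.
Proof.
rewrite big_mkcond !big_ord_recl big_ord0.
by case: i => [[|[|[|m]]] hm] //=; rewrite ?addr0 ?add0r mulr_natl mulr2n.
Qed.

Lemma sum_clique_eq (i : 'I_3) :
  \sum_(u < n - 6 | u == i :> nat) (if (u < 3)%N then A else 1) = A.
Proof.
have hi : (i < n - 6)%N by apply: leq_trans (ltn_ord i) _; clear -n33; lia.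
by rewrite (big_pred1 (Ordinal hi)) //= ltn_ord.
Qed.

Lemma EP_harmonic v : \sum_(u | EP_adj v u) EP_weight u = rho * EP_weight v.
Proof.
have qn0 : rho ^+ 2 - 2 * rho - 1 != 0 by apply: lt0r_neq0.
case: v => [u|[i|i]]; rewrite !big_sumType /=.
- have -> : \sum_(j < n - 6 | u != j) (if (j < 3)%N then A else 1)
      = k + 3 * (A - 1) - (if (u < 3)%N then A else 1).
    rewrite -sum_EP_clique [in RHS](bigD1 u) //= addrAC subrr add0r.
    by apply: eq_bigl => j; rewrite eq_sym.
  rewrite !sum_ord3; case: ifP => _; last by rewrite /A; lra.
  have rE : A * ((rho - 2) * q - 2 * rho) = (k - 3) * q.
    by move: rhoE; rewrite /EP_quartic -/q /A; move: (rho - k + 4) => a; lra.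
  have -> : B + C = A * (2 * rho) / q.
    by rewrite /B /C -mulrDl -mulrDr; congr (_ * _ / _); ring.
  apply: (mulIf (lt0r_neq0 q0)); rewrite mulrDl divfK ?lt0r_neq0 //.
  by lra.
- rewrite sum_clique_eq sum_ord3_neq (big_pred1 i) => [|j]; last by rewrite eq_sym.
  by rewrite /B /C /q; field.
- rewrite sum_clique_eq big_pred0_eq addr0 (big_pred1 i) //.
  by rewrite /B /C /q; field.
Qed.
End Vector.

End EPEigenvector.

Ltac split_neqs := repeat match goal with
  | H : is_true (_ && _) |- _ => case/andP: H => ? ?
  end.

Ltac rewrite_neqs := repeat match goal with
  | H : is_true (~~ (?x == ?y)) |- context [?x == ?y] => rewrite (negbTE H)
  | H : is_true (~~ (?x == ?y)) |- context [?y == ?x] => rewrite [y == x]eq_sym (negbTE H)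
  end.

(** * A strictly superharmonic weight on the second shape *)

Section ThetaWeight.
Import Order.TTheory GRing.Theory Num.Theory.
Local Open Scope ring_scope.
Variable R : rcfType.

Section Inequalities.
Variables k rho : R.
Hypotheses (k27 : 27 <= k) (rho_lo : k - 1 < rho) (rho_hi : rho <= k).
Hypothesis rhoE : EP_quartic k rho.

(* The values 2/5 and 1/5 leave slack in all four eigenvalue inequalities: with
   [x] the excess of [rho] over [k - 1], the quartic amounts to
   [x * q * (rho + 1) = 6 * rho * (1 + x / 3)], where [q = rho^2 - 2 rho - 1]. *)
Definition theta_alpha : R := 1 + 2 * (rho - (k - 1)) / 5.
Definition theta_beta : R := (rho - (k - 1)) * (rho + 1) / 5.
Definition theta_gamma : R := theta_beta / 5.

Lemma theta_beta_gt0 : 0 < theta_beta.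
Proof.
rewrite /theta_beta; have h1 := rho_lo; have h2 := k27.
by rewrite divr_gt0 // mulr_gt0 //; lra.
Qed.

Lemma theta_ineq_clique : k - 3 + 2 * theta_alpha < rho.
Proof. by rewrite /theta_alpha; have h1 := rho_lo; lra. Qed.

(** With [x = rho - (k - 1)], the difference of the two sides is exactly [x / 5], as it is in
    [theta_ineq_clique]. *)
Lemma theta_ineq_alpha : k - 2 + theta_alpha + 2 * theta_beta < rho * theta_alpha.
Proof.
rewrite /theta_alpha /theta_beta; have h1 := rho_lo; have h2 := k27.
have [x x0 kE] : exists2 x, 0 < x & k = rho + 1 - x.
  by exists (rho - (k - 1)); [lra | ring].
rewrite kE; nra.
Qed.

(** Here the quartic enters. To leading order in [rho] it makes [theta_beta * rho] equal to
    [6 / 5 + 2 x / 5], against [theta_alpha = 1 + 2 x / 5]. *)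
Lemma theta_ineq_beta : theta_alpha + 2 * theta_beta + theta_gamma < rho * theta_beta.
Proof.
have h1 := rho_lo; have h2 := k27; have h3 := rho_hi; have rho26 : 26 < rho by lra.
have q0 := EP_quad_gt0 rho26.
have [x [x0 x1 kE]] : exists x, [/\ 0 < x, x <= 1 & k = rho + 1 - x].
  by exists (rho - (k - 1)); split; [lra | lra | ring].
have bq : theta_beta * (rho ^+ 2 - 2 * rho - 1) = 6 / 5 * rho * (1 + x / 3).
  by have := rhoE; rewrite /EP_quartic /theta_beta kE; lra.
have aE : theta_alpha = 1 + 2 / 5 * x by rewrite /theta_alpha kE; field.
suff : theta_alpha < theta_beta * (rho - 11 / 5) by rewrite /theta_gamma; lra.
rewrite -(ltr_pM2r q0) aE [ltRHS]mulrAC bq; nra.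
Qed.

Lemma theta_ineq_gamma : 2 * theta_beta < rho * theta_gamma.
Proof.
have h1 := rho_lo; have h2 := k27; have b0 := theta_beta_gt0.
by rewrite /theta_gamma; nra.
Qed.
End Inequalities.

Lemma sum_mem_le (T : finType) (w : T -> R) (l : seq T) : (forall u, 0 <= w u) ->
  \sum_(u in l) w u <= \sum_(u <- l) w u.
Proof.
move=> w0; elim: l => [|a l IHl]; first by rewrite big_nil big_pred0.
rewrite big_cons (bigD1 a) ?mem_head //= lerD2l; apply: le_trans IHl.
rewrite big_mkcond [leRHS]big_mkcond /=; apply: ler_sum => u _.
by rewrite inE; case: (u == a); case: (u \in l) => /=.
Qed.

Lemma sum_nbr_le (T : finType) (w : T -> R) (P : pred T) (A : {set T}) (l : seq T) :
  (forall u, 0 <= w u) -> (forall u, P u -> (u \in A) || (u \in l)) ->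
  \sum_(u | P u) w u <= \sum_(u in A) w u + \sum_(u <- l) w u.
Proof.
move=> w0 sub; rewrite (bigID (mem A)) /=; apply: lerD.
  rewrite big_mkcond [leRHS]big_mkcond /=; apply: ler_sum => u _.
  by case: (P u); case: (u \in A).
apply: le_trans (sum_mem_le l w0).
rewrite big_mkcond [leRHS]big_mkcond /=; apply: ler_sum => u _.
by case: ifP => [/andP[/sub]|]; [case: (u \in A) => //= -> | case: ifP].
Qed.

Variables (T : finType) (e : rel T) (K : {set T}) (n : nat) (k rho : R) (y : T -> R).
Variables a b u1 u2 u3 v1 v2 v3 : T.
Hypotheses (e_sym : symmetric e) (e_irr : irreflexive e).
Hypotheses (n33 : (33 <= n)%N) (Tn : #|T| = n) (kE : k = (n - 6)%:R).
Hypotheses (rho_lo : k - 1 < rho) (rho_hi : rho <= k) (rhoE : EP_quartic k rho).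
Hypothesis cfg : theta_config e K a b u1 u2 u3 v1 v2 v3.
Hypothesis edges : forall z w, e z w ->
  [|| inK K z && inK K w, (z, w) \in theta_edges a b u1 u2 u3 v1 v2 v3
    | (w, z) \in theta_edges a b u1 u2 u3 v1 v2 v3].

Let k27 : 27 <= k. Proof. by rewrite kE ler_nat; clear -n33; lia. Qed.

Definition theta_weight (x : T) : R :=
  if x \in K then if (x == a) || (x == b) then theta_alpha k rho else 1
  else if (x == u2) || (x == v2) then theta_gamma k rho else theta_beta k rho.

Lemma theta_weight_gt0 x : 0 < theta_weight x.
Proof.
have b0 := theta_beta_gt0 k27 rho_lo; have h := rho_lo.
rewrite /theta_weight; case: ifP => _; case: ifP => _ //.
  by rewrite /theta_alpha; lra.
by rewrite /theta_gamma; lra.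
Qed.

Lemma card_theta_clique : #|K|%:R = k.
Proof.
case: cfg => U8 _ out _.
have -> : #|K| = (n - 6)%N; last by [].
have U6 : uniq [:: u1; u2; u3; v1; v2; v3].
  by apply: subseq_uniq U8; exact: (suffix_subseq [:: a; b]).
have : #|~: K| = 6%N by rewrite -[RHS](card_uniqP U6); apply: eq_card => x; rewrite out inE.
by have := cardsC K; rewrite Tn; clear; lia.
Qed.

Lemma sum_theta_clique : \sum_(x in K) theta_weight x = k - 2 + 2 * theta_alpha k rho.
Proof.
case: cfg => U8 /= /and3P[aK bK _] out _.
have ab : b != a by move: U8; rewrite /= inE negb_or eq_sym => /andP[/andP[]].
rewrite (bigD1 a) //= (bigD1 b) /=; last by rewrite ab andbT.
rewrite (eq_bigr (fun=> 1)) => [|x /andP[/andP[xK xa] xb]]; last first.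
  by rewrite /theta_weight xK (negbTE xa) (negbTE xb).
have card2 : (\sum_(i | (i \in K) && (i != a) && (i != b)) 1 : R) = k - 2.
  have := card_theta_clique; rewrite -sumr_const (bigD1 a) //= (bigD1 b) /=.
    2: by rewrite ab andbT.
  lra.
rewrite card2 /theta_weight !ifT ?eqxx ?orbT //; lra.
Qed.

Lemma sum_theta_clique1 z : z \in K ->
  \sum_(x in K :\ z) theta_weight x = k - 2 + 2 * theta_alpha k rho - theta_weight z.
Proof.
move=> zK; rewrite -sum_theta_clique [X in X - _](bigD1 z) //= addrAC subrr add0r.
by apply: eq_bigl => x; rewrite !inE andbC.
Qed.

Ltac nbr_cases := move/edges; rewrite /theta_edges !inE !xpair_eqE;
  rewrite_neqs; rewrite ?eqxx;
  repeat match goal with H : inK K ?x = _ |- context [inK K ?x] => rewrite H end;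
  rewrite /inK;
  rewrite /= ?andbF ?andbT;
  repeat match goal with |- context [?w == ?x] => case: (w == x) => //= end.

(** As the weight is positive, each neighbourhood may be enlarged to what [theta_edges] permits; the
    four inequalities then match the four kinds of vertices. *)
Lemma theta_strict z : \sum_(u | e z u) theta_weight u < rho * theta_weight z.
Proof.
have i1 := theta_ineq_clique rho_lo; have i2 := theta_ineq_alpha k27 rho_lo.
have i3 := theta_ineq_beta k27 rho_lo rho_hi rhoE; have i4 := theta_ineq_gamma k27 rho_lo.
case: cfg => U8 /= /and3P[aK bK _] out _.
have {}aK : inK K a = true := aK.
have {}bK : inK K b = true := bK.
have outK x : x \in [:: u1; u2; u3; v1; v2; v3] -> (x \in K) = false.
  by rewrite out => /negbTE.
have [u1K u2K u3K] : [/\ inK K u1 = false, inK K u2 = false & inK K u3 = false].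
  by split; apply: outK; rewrite !inE eqxx ?orbT.
have [v1K v2K v3K] : [/\ inK K v1 = false, inK K v2 = false & inK K v3 = false].
  by split; apply: outK; rewrite !inE eqxx ?orbT.
have neqs := U8; rewrite /= !inE !negb_or in neqs; split_neqs.
have w0 u : 0 <= theta_weight u := ltW (theta_weight_gt0 u).
have wa : theta_weight a = theta_alpha k rho by rewrite /theta_weight -/(inK K a) aK eqxx.
have wb : theta_weight b = theta_alpha k rho by rewrite /theta_weight -/(inK K b) bK eqxx orbT.
have wu1 : theta_weight u1 = theta_beta k rho.
  by rewrite /theta_weight -/(inK K u1) u1K; rewrite_neqs.
have wu3 : theta_weight u3 = theta_beta k rho.
  by rewrite /theta_weight -/(inK K u3) u3K; rewrite_neqs.
have wv1 : theta_weight v1 = theta_beta k rho.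
  by rewrite /theta_weight -/(inK K v1) v1K; rewrite_neqs.
have wv3 : theta_weight v3 = theta_beta k rho.
  by rewrite /theta_weight -/(inK K v3) v3K; rewrite_neqs.
have wu2 : theta_weight u2 = theta_gamma k rho.
  by rewrite /theta_weight -/(inK K u2) u2K eqxx.
have wv2 : theta_weight v2 = theta_gamma k rho.
  by rewrite /theta_weight -/(inK K v2) v2K eqxx orbT.
have out_bound (l : seq T) : (forall u, e z u -> u \in l) ->
    \sum_(u | e z u) theta_weight u <= \sum_(u <- l) theta_weight u.
  move=> sub; apply: le_trans (sum_nbr_le (A := finset.set0) (l := l) w0 _) _.
    by move=> u /sub ->; rewrite orbT.
  by rewrite big_set0 add0r.
have [zK|zK] := boolP (z \in K); last first.
  have : z \in [:: u1; u2; u3; v1; v2; v3] by rewrite out.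
  rewrite !inE => /or4P[|||/or3P[]] /eqP zE; rewrite zE in out_bound *.
  - apply: (le_lt_trans (out_bound [:: a; v1; u2; u3] _)); first by move=> u; nbr_cases.
    rewrite !big_cons big_nil wa wv1 wu2 wu3 wu1; lra.
  - apply: (le_lt_trans (out_bound [:: u1; u3] _)); first by move=> u; nbr_cases.
    rewrite !big_cons big_nil wu1 wu3 wu2; lra.
  - apply: (le_lt_trans (out_bound [:: b; v3; u2; u1] _)); first by move=> u; nbr_cases.
    rewrite !big_cons big_nil wb wv3 wu2 wu1 wu3; lra.
  - apply: (le_lt_trans (out_bound [:: a; u1; v2; v3] _)); first by move=> u; nbr_cases.
    rewrite !big_cons big_nil wa wu1 wv2 wv3 wv1; lra.
  - apply: (le_lt_trans (out_bound [:: v1; v3] _)); first by move=> u; nbr_cases.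
    rewrite !big_cons big_nil wv1 wv3 wv2; lra.
  - apply: (le_lt_trans (out_bound [:: b; u3; v2; v1] _)); first by move=> u; nbr_cases.
    rewrite !big_cons big_nil wb wu3 wv2 wv1 wv3; lra.
have in_bound (l : seq T) : (forall u, e z u -> (u \in K :\ z) || (u \in l)) ->
    \sum_(u | e z u) theta_weight u
      <= k - 2 + 2 * theta_alpha k rho - theta_weight z + \sum_(u <- l) theta_weight u.
  by rewrite -sum_theta_clique1 //; apply: sum_nbr_le.
have zK' u : e z u -> u != z by apply: contraTneq => ->; rewrite e_irr.
have [za|za] := eqVneq z a.
  rewrite za in zK' in_bound *; apply: (le_lt_trans (in_bound [:: u1; v1] _)).
    by move=> u au; have := zK' u au; move: au; rewrite !inE => + ->; nbr_cases.
  rewrite !big_cons big_nil wa wu1 wv1; lra.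
have [zb|zb] := eqVneq z b.
  rewrite zb in zK' in_bound *; apply: (le_lt_trans (in_bound [:: u3; v3] _)).
    by move=> u au; have := zK' u au; move: au; rewrite !inE => + ->; nbr_cases.
  rewrite !big_cons big_nil wb wu3 wv3; lra.
have wz : theta_weight z = 1 by rewrite /theta_weight zK (negbTE za) (negbTE zb).
have zout x : inK K x = false -> z != x by apply: contraFneq => <-; exact: zK.
have [zu1 zu2 zu3] : [/\ z != u1, z != u2 & z != u3] by split; apply: zout.
have [zv1 zv2 zv3] : [/\ z != v1, z != v2 & z != v3] by split; apply: zout.
have zK1 : inK K z = true := zK.
apply: (le_lt_trans (in_bound [::] _)).
  by move=> u zu; have := zK' u zu; move: zu; rewrite !inE => + ->; nbr_cases.
rewrite big_nil wz; lra.
Qed.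

Lemma theta_no_subharmonic : ~ subharmonic e rho y.
Proof.
by move=> sub; apply: (strict_weight_contra e_sym sub theta_weight_gt0 theta_strict).
Qed.
End ThetaWeight.

(** * The extremal graph *)

Lemma graph_isoI (G H : sgraph) (f : H -> G) : bijective f ->
  (forall x y, adj (f x) (f y) = adj x y) -> graph_iso G H.
Proof.
case=> g fK gK fadj; exists g; first by exists f.
by move=> x y; rewrite -fadj !gK.
Qed.

Lemma claw_free_clawfree (G : sgraph) : claw_free G -> clawfree (@adj G).
Proof.
move=> cfG c x y z cx cy cz xy xz yz; apply: contraT; rewrite !negb_or => /and3P[nxy nxz nyz].
have neq (u v : G) : adj u v -> u != v by apply: contraTneq => ->; rewrite adj_irr.
pose S := [set u in [:: c; x; y; z]].
have U4 : uniq [:: c; x; y; z].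
  by rewrite /= !inE !negb_or (neq _ _ cx) (neq _ _ cy) (neq _ _ cz) xy xz yz.
pose g (u : Kmn 1 3) : G := match u with inl _ => c | inr i => nth c [:: x; y; z] i end.
have gS u : g u \in S.
  by rewrite inE; case: u => [i|i]; rewrite ?mem_head // inE mem_nth ?orbT.
pose g' (u : Kmn 1 3) : induced S := exist _ (g u) (gS u).
have g_inj : injective g'.
  move=> u v /(congr1 val) /=; case: u v => [i|i] [j|j] /=.
  - by rewrite (ord1 i) (ord1 j).
  - move=> cE; case/andP: U4 => /negP[]; rewrite [X in X \in _]cE mem_nth //.
  - move=> cE; case/andP: U4 => /negP[]; rewrite -[X in X \in _]cE mem_nth //.
  - move/eqP; rewrite nth_uniq //; last by case/andP: U4.
    by move/eqP/val_inj ->.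
case: (cfG S); apply: (@graph_isoI _ _ g').
  apply: inj_card_bij => //; rewrite card_sum !card_ord card_sig.
  rewrite (_ : #|_| = #|S|); last by apply: eq_card.
  by rewrite cardsE (card_uniqP U4).
have sym3 (i j : 'I_3) : adj (nth c [:: x; y; z] i) (nth c [:: x; y; z] j) = false.
  by case: i j => [[|[|[|?]]] ?] // [[|[|[|?]]] ?] //=;
    rewrite ?adj_irr //; apply/negbTE => //; rewrite adj_sym.
move=> [i|i] [j|j]; rewrite /= /induced_adj /= ?adj_irr ?sym3 //.
  by case: j => [[|[|[|?]]] ?].
by rewrite adj_sym; case: i => [[|[|[|?]]] ?].
Qed.

(** If no edge left [D] outside [X], then [D] would be a union of components of the connected graph
    [G - X]. *)
Lemma k_connected_crossing (G : sgraph) (X : {set G}) (D : pred G) :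
  k_connected 2 G -> #|X| < 2 ->
  (exists2 d, d \notin X & D d) -> (exists2 z, z \notin X & ~~ D z) ->
  exists d c, [/\ D d, ~~ D c, c \notin X & adj d c].
Proof.
move=> [_ con] X2 [d dX Dd] [z zX Dz].
have [/existsP[d' /existsP[c' /and4P[? ? ? ?]]]|none] := boolP
    [exists d', exists c', [&& D d', ~~ D c', c' \notin X & adj d' c']].
  by exists d', c'.
have dX' : d \in ~: X by rewrite inE.
have zX' : z \in ~: X by rewrite inE.
pose d0 : induced (~: X) := exist _ d dX'; pose z0 : induced (~: X) := exist _ z zX'.
have := con X X2 d0 z0; have clo : closed (@adj (induced (~: X))) [pred u | D (val u)].
  have half (u v : induced (~: X)) : adj u v -> D (val u) -> D (val v).
    move=> uv Du; apply: contraNT none => Dv.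
    apply/existsP; exists (val u); apply/existsP; exists (val v).
    rewrite Du Dv; have := valP v; rewrite inE => ->; exact: uv.
  move=> u v uv; rewrite !inE; apply/idP/idP; first exact: half.
  by apply: half; rewrite adj_sym.
by move/(closed_connect clo); rewrite !inE /= Dd (negbTE Dz).
Qed.

(** * Embedding the first shape in the extremal graph *)

Section EPEmbedding.
Variables (G : sgraph) (h : rel G) (K : {set G}) (n : nat).
Variables a1 a2 a3 c1 c2 c3 b1 b2 b3 : G.
Hypotheses (h_irr : irreflexive h) (Gn : #|G| = n).
Hypothesis cfg : EP_config h K a1 a2 a3 c1 c2 c3 b1 b2 b3.
Hypothesis edges : forall z w, h z w ->
  [|| inK K z && inK K w, (z, w) \in EP_edges a1 a2 a3 c1 c2 c3 b1 b2 b3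
    | (w, z) \in EP_edges a1 a2 a3 c1 c2 c3 b1 b2 b3].

(** The attachment vertices come first, to receive the indices 0, 1, 2 that [EP] distinguishes. *)
Definition EP_clique : seq G :=
  [:: a1; a2; a3] ++ [seq x <- enum K | x \notin [:: a1; a2; a3]].

Definition EP_map (v : EP n) : G :=
  match v with
  | inl i => nth a1 EP_clique i
  | inr (inl i) => nth b1 [:: b1; b2; b3] i
  | inr (inr i) => nth c1 [:: c1; c2; c3] i
  end.

Lemma EP_clique_uniq : uniq EP_clique.
Proof.
case: cfg => U9 _ _ _; rewrite cat_uniq filter_uniq ?enum_uniq // andbT.
apply/andP; split; first by apply: (uniq_sub U9) => P; counts.
by apply/hasPn => x; rewrite mem_filter => /andP[].
Qed.

Lemma mem_EP_clique x : (x \in EP_clique) = inK K x.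
Proof.
case: cfg => _ aK _ _; rewrite mem_cat mem_filter mem_enum.
by case: (boolP (x \in [:: a1; a2; a3])) => //= /(allP aK) ->.
Qed.

Lemma card_outside : #|~: K| = 6.
Proof.
case: cfg => U9 _ out _.
have U6 : uniq [:: c1; c2; c3; b1; b2; b3] by apply: (uniq_sub U9) => P; counts.
by rewrite -[RHS](card_uniqP U6); apply: eq_card => x; rewrite out inE.
Qed.

Lemma size_EP_clique : size EP_clique = n - 6.
Proof.
rewrite -(card_uniqP EP_clique_uniq) -Gn -card_outside -(cardsC K) addnK.
by apply: eq_card => x; rewrite mem_EP_clique.
Qed.

Lemma EP_map_clique (i : 'I_(n - 6)) : inK K (EP_map (inl i)).
Proof. by rewrite -mem_EP_clique mem_nth // size_EP_clique. Qed.


Lemma EP_map_a (u : 'I_(n - 6)) j : j < 3 ->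
  (EP_map (inl u) == nth a1 [:: a1; a2; a3] j) = (u == j :> nat).
Proof.
move=> j3; have sz := size_EP_clique; have szL : 2 < size EP_clique by [].
rewrite (_ : nth a1 [:: a1; a2; a3] j = nth a1 EP_clique j); last by rewrite nth_cat j3.
by rewrite nth_uniq ?EP_clique_uniq ?sz // -sz; apply: leq_trans szL.
Qed.

Ltac EP_cases := move/edges; rewrite /EP_edges !inE !xpair_eqE;
  rewrite_neqs; rewrite ?eqxx;
  repeat match goal with H : inK K ?x = _ |- context [inK K ?x] => rewrite H end;
  rewrite /= ?andbF ?andbT ?orbF //=.

Lemma EP_map_adj u v : h (EP_map u) (EP_map v) -> EP_adj u v.
Proof.
case: cfg => U9 /= /and4P[a1K a2K a3K _] out _.
have outK x : x \in [:: c1; c2; c3; b1; b2; b3] -> inK K x = false.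
  by rewrite out => /negbTE.
have [c1K c2K c3K] : [/\ inK K c1 = false, inK K c2 = false & inK K c3 = false].
  by split; apply: outK; rewrite !inE eqxx ?orbT.
have [b1K b2K b3K] : [/\ inK K b1 = false, inK K b2 = false & inK K b3 = false].
  by split; apply: outK; rewrite !inE eqxx ?orbT.
have neqs := U9; rewrite /= !inE !negb_or in neqs; split_neqs.
have clique_neq (i : 'I_(n - 6)) x : inK K x = false -> EP_map (inl i) != x.
  by apply: contraFneq => <-; apply: EP_map_clique.
have neqs' i := (clique_neq i _ c1K, clique_neq i _ c2K, clique_neq i _ c3K).
have neqs'' i := (clique_neq i _ b1K, clique_neq i _ b2K, clique_neq i _ b3K).
have adj_cb (i : 'I_(n - 6)) (j : 'I_3) w : w = inl j \/ w = inr j ->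
    h (EP_map (inl i)) (EP_map (inr w)) || h (EP_map (inr w)) (EP_map (inl i)) ->
    i == j :> nat.
  have m0 := EP_map_a i (isT : 0 < 3); have m1 := EP_map_a i (isT : 1 < 3).
  have m2 := EP_map_a i (isT : 2 < 3); have xK := EP_map_clique i.
  have [[x1 x2] x3] := neqs' i; have [[y1 y2] y3] := neqs'' i.
  move: m0 m1 m2 xK x1 x2 x3 y1 y2 y3; set x := EP_map (inl i) => /=.
  move=> m0 m1 m2 xK x1 x2 x3 y1 y2 y3.
  have {}xK : inK K x = true := xK.
  by case: j => [[|[|[|?]]] ?] // [] -> /=; case/orP; EP_cases; rewrite ?m0 ?m1 ?m2.
case: u v => [u|[i|i]] [v|[j|j]].
- by apply: contraTneq => ->; rewrite h_irr.
- by move=> H; apply: (adj_cb _ _ (inl j)); rewrite ?H; auto.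
- by move=> H; apply: (adj_cb _ _ (inr j)); rewrite ?H; auto.
- by move=> H; apply: (adj_cb _ _ (inl i)); rewrite ?H ?orbT; auto.
- by apply: contraTneq => ->; rewrite h_irr.
- by case: i j => [[|[|[|?]]] ?] // [[|[|[|?]]] ?] //=; EP_cases.
- by move=> H; apply: (adj_cb _ _ (inr i)); rewrite ?H ?orbT; auto.
- by case: i j => [[|[|[|?]]] ?] // [[|[|[|?]]] ?] //=; EP_cases.
- by case: i j => [[|[|[|?]]] ?] // [[|[|[|?]]] ?] //=; rewrite ?h_irr //; EP_cases.
Qed.

Lemma EP_map_inj : injective EP_map.
Proof.
case: (cfg) => U9 /= /and4P[a1K a2K a3K _] out _.
have outK (x : G) : x \in [:: c1; c2; c3; b1; b2; b3] -> ~~ inK K x by rewrite out.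
have inKE v : inK K (EP_map v) = if v is inl _ then true else false.
  case: v => [i|[i|i]]; first exact: EP_map_clique.
    apply/negbTE/outK; rewrite (mem_cat _ [:: c1; c2; c3] [:: b1; b2; b3]).
    by rewrite [X in _ || X]mem_nth ?orbT.
  apply/negbTE/outK; rewrite (mem_cat _ [:: c1; c2; c3] [:: b1; b2; b3]).
  by rewrite mem_nth.
have Ub : uniq [:: b1; b2; b3] by apply: (uniq_sub U9) => P; counts.
have Uc : uniq [:: c1; c2; c3] by apply: (uniq_sub U9) => P; counts.
have Ubc : uniq ([:: c1; c2; c3] ++ [:: b1; b2; b3]) by apply: (uniq_sub U9) => P; counts.
have nbc (i j : 'I_3) : EP_map (inr (inl i)) <> EP_map (inr (inr j)).
  move=> E; move: Ubc; rewrite cat_uniq => /and3P[_ /hasPn/(_ (EP_map (inr (inl i)))) + _].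
  by rewrite /= in E *; rewrite mem_nth // => /(_ isT); rewrite E mem_nth.
move=> u v E; have := congr1 (inK K) E; rewrite !inKE.
case: u v E => [u|[i|i]] [v|[j|j]] E // _.
- move/eqP: E; rewrite nth_uniq ?EP_clique_uniq ?size_EP_clique //.
  by move/eqP/val_inj->.
- by move/eqP: E; rewrite /= nth_uniq // => /eqP/val_inj->.
- by case: (nbc _ _ E).
- by case: (nbc _ _ (esym E)).
- by move/eqP: E; rewrite /= nth_uniq // => /eqP/val_inj->.
Qed.

Lemma EP_map_bij : 6 <= n -> bijective EP_map.
Proof.
move=> n6; apply: (inj_card_bij EP_map_inj).
by rewrite !card_sum !card_ord Gn subnK.
Qed.

End EPEmbedding.

Section SpectralRigidity.
Import Order.TTheory GRing.Theory Num.Theory.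
Local Open Scope ring_scope.
Variables (R : rcfType) (G H : sgraph) (f : H -> G) (rho : R).
Hypothesis f_bij : bijective f.

Lemma subharmonic_pull e (y : G -> R) : subharmonic e rho y ->
  subharmonic (fun u v => e (f u) (f v)) rho (fun u => y (f u)).
Proof.
case=> y0 [v yv] yrho; have [g fK gK] := f_bij.
split=> [u||u]; first exact: y0.
  by exists (g v); rewrite gK.
apply: le_trans (yrho (f u)) _; rewrite (reindex f) //.
by exists g => z _.
Qed.

Lemma iso_of_subharmonic (y : G -> R) (w : H -> R) :
  (forall D : pred G, (exists d, D d) -> (exists c, ~~ D c) ->
     exists d c, [/\ D d, ~~ D c & adj d c]) ->
  subharmonic adj rho y -> (forall u v, adj (f u) (f v) -> adj u v) ->
  (forall v, 0 < w v) -> (forall v, \sum_(u | adj v u) w u = rho * w v) ->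
  graph_iso G H.
Proof.
move=> conn suby sub w0 wrho; have [g fK gK] := f_bij.
apply: (@graph_isoI G H f f_bij) => u v.
apply: (subharmonic_rigid (e := fun u v => adj (f u) (f v)) (e' := adj) _ _ _ _
  (subharmonic_pull suby) w0 wrho) => //.
- by move=> s t; rewrite adj_sym.
- by move=> s t; rewrite adj_sym.
move=> D [d Dd] [c Dc].
have [||d' [c' [Dd' Dc' dc']]] := conn (fun z => D (g z)).
- by exists (f d); rewrite fK.
- by exists (f c); rewrite fK.
by exists (g d'), (g c'); rewrite !gK.
Qed.
End SpectralRigidity.

Theorem theorem8 (R : realType) (n : nat) (G : sgraph) :
  33 <= n -> #|G| = n ->
  k_connected 2 G -> claw_free G ->
  (spectral_radius R (EP n) <= spectral_radius R G)%R ->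
  ~ graph_iso G (EP n) -> hamiltonian G.
Proof.
move=> n33 Gn con cfG le_sr niso; apply: boolp.contrapT => nham.
have [h [[h_sym h_irr h_cf] [sub_h nh h_df]]] :=
  exists_closure (@adj_sym G) (@adj_irr G) (claw_free_clawfree cfG) nham.
pose k : R := ((n - 6)%:R)%R.
have k27 : (27 <= k)%R by rewrite /k Num.Theory.ler_nat; clear -n33; lia.
have [rho [rho_lo rho_hi rhoE]] := EP_quartic_root k27.
have w0 := @EP_weight_gt0 R n k rho n33 erefl rho_lo.
have wrho := @EP_harmonic R n k rho n33 erefl rho_lo rhoE.
have rho0 : (0 < rho)%R by lra.
have EP0 : 0 < #|EP n| by rewrite !card_sum !card_ord; clear; lia.
have rho_EP : (rho <= spectral_radius R (EP n))%R.
  apply: (@spectral_ge R (EP n) rho (@EP_weight R n k rho)); last exact: wrho.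
  have /card_gt0P[v _] := EP0.
  by exists v; apply: Num.Theory.lt0r_neq0.
have [y suby] := spectral_subharmonic rho0 (Order.POrderTheory.le_trans rho_EP le_sr).
have suby_h := subharmonic_sub sub_h suby.
have [v deg] := degree_sum h_sym (Order.POrderTheory.ltW rho0) suby_h.
have {}deg : (#|G| - 7) ^ 2 <= \sum_(u in nbr h v) #|nbr h u|.
  rewrite -(Num.Theory.ler_nat R) GRing.natrX GRing.natr_sum.
  rewrite (eq_bigl (h v)) => [|u]; last by rewrite inE.
  apply: Order.POrderTheory.le_trans deg.
  (* Since [rho > k - 1 = n - 7], the real bound yields one between natural numbers. *)
  rewrite Gn (_ : ((n - 7)%:R = k - 1 :> R)%R); first by nra.
  have nE : n - 6 = (n - 7).+1 by clear -n33; lia.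
  by rewrite /k nE -GRing.natr1 GRing.addrK.
have T2 : 2 < #|G| by rewrite Gn; clear -n33; lia.
have T33 : 33 <= #|G| by rewrite Gn.
have [K [K_clique K_one K_att R6]] := exists_big_clique h_sym h_irr h_cf h_df T33 deg.
have K2 : 1 < #|K| by have := cardsC K; move: R6; rewrite Gn; clear -n33; lia.
have conn2 (D : pred G) c : (exists d, D d) -> ~~ D c -> (exists2 z, z != c & ~~ D z) ->
    exists d c', [/\ D d, ~~ D c', c' != c & h d c'].
  move=> [d Dd] Dc [z zc Dz].
  have [|||d' [c' [Dd' Dc' cc' dc']]] := @k_connected_crossing G [set c] D con.
  - by rewrite cards1.
  - by exists d; rewrite // inE; apply: contraNneq Dc => <-.
  - by exists z; rewrite // inE.
  by exists d', c'; split=> //; [rewrite inE in cc' | apply: sub_h].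
have conn1 (D : pred G) : (exists d, D d) -> (exists c, ~~ D c) ->
    exists d c, [/\ D d, ~~ D c & adj d c].
  move=> [d Dd] [c Dc].
  have [|||d' [c' [Dd' Dc' _ dc']]] := @k_connected_crossing G finset.set0 D con.
  - by rewrite cards0.
  - by exists d; rewrite ?inE.
  - by exists c; rewrite ?inE.
  by exists d', c'.
have [] := nonham_config h_sym h_cf T2 K_clique K_one K_att R6 K2 conn2 nh.
  case=> a1 [a2 [a3 [c1 [c2 [c3 [b1 [b2 [b3 cfg]]]]]]]]; apply: niso.
  have edges z w := @EP_config_edges _ _ _ h_sym h_irr T2 K_clique K_one K_att nh
    _ _ _ _ _ _ _ _ _ z w cfg.
  (* Edges of [G] are edges of [h], hence of [EP_n] through [EP_map]. Rigidity with [y], subharmonic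
     on [G] itself, makes the inclusion of [G] an equality. *)
  apply: (iso_of_subharmonic (EP_map_bij Gn cfg _) conn1 suby _ w0 wrho).
    by clear -n33; lia.
  by move=> u w /sub_h; apply: (EP_map_adj h_irr Gn cfg edges).
case=> a [b [u1 [u2 [u3 [v1 [v2 [v3 cfg]]]]]]].
have edges z w := @theta_config_edges _ _ _ h_sym h_irr T2 K_clique K_one K_att nh
  _ _ _ _ _ _ _ _ z w cfg.
exact: (theta_no_subharmonic h_sym h_irr n33 Gn erefl rho_lo rho_hi rhoE cfg edges suby_h).
Qed.
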